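(* Fix any $z\in\mathbb{R}^2$ and $\delta>0$. Let $B^z$ be a planar Brownian motion started from $z$ and let $\tau^z_\delta:=\inf\{t\ge0:|B^z_t-z|=\delta\}$. Then, for almost every Brownian path $B^z$, there is an $\varepsilon=\varepsilon(\delta,B^z)>0$ such that, for all $b\in C([0,\tau^z_\delta],\mathbb{R}^2)$ with $\max_{[0,\tau^z_\delta]}|b-B^z|<\varepsilon$, there exists a bounded open neighborhood $V=V(\delta,B^z,b)$ of $z$ such that $\partial V\subset b_{[0,\tau^z_\delta]}$.
   Context: For a path $b$ and an interval $[t_1,t_2]$ in its domain, $b_{[t_1,t_2]}:=\{b(t):t\in[t_1,t_2]\}$ denotes its range over $[t_1,t_2]$. $\partial V$ is the topological boundary of $V$. *)

(* Defs.v *)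
From mathcomp Require Import all_boot all_order all_algebra.
From mathcomp Require Import all_classical all_reals all_analysis.

Set Implicit Arguments.
Unset Strict Implicit.
Unset Printing Implicit Defensive.

Import Order.TTheory GRing.Theory Num.Theory.
Import numFieldNormedType.Exports.
Local Open Scope classical_set_scope.
Local Open Scope ring_scope.

(* The canonical norm on R * R is the max norm, so the Euclidean norm is defined
   here.  The two norms are equivalent, hence the canonical notions of
   open, closed, bounded and continuous on R * R are the Euclidean ones. *)
Definition enorm (R : realType) (x : R * R) : R :=
  Num.sqrt (x.1 ^+ 2 + x.2 ^+ 2).

Definition boundary (T : topologicalType) (V : set T) : set T :=
  closure V `\` interior V.

(* normal_prob m s is N(m, s^2): its second parameter is the standard deviation,
   so this is the law N(0, h I_2). *)
Definition planar_gaussian (R : realType) (h : R) : set (R * R) -> \bar R :=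
  (normal_prob 0 (Num.sqrt h) \x normal_prob 0 (Num.sqrt h))%E.

Section planar_brownian_motion.
Context {R : realType} {d : measure_display} {Omega : measurableType d}.
Variables (P : probability Omega R) (B : R -> Omega -> R * R).

(* Letting some of the A i be the full plane gives the product rule for every
   subfamily, so this is mutual independence of the n increments. *)
Definition independent_increments : Prop :=
  forall (n : nat) (t : nat -> R),
    0 <= t 0%N -> (forall i, (i < n)%N -> t i <= t i.+1) ->
  forall A : nat -> set (R * R), (forall i, measurable (A i)) ->
    P (\bigcap_(i in `I_n) [set w | A i ((B (t i.+1) w - B (t i) w)%R)]) =
    (\prod_(i < n) P [set w | A i ((B (t i.+1) w - B (t i) w)%R)])%E.

Definition gaussian_increments : Prop :=
  forall s t : R, 0 <= s -> s < t -> forall A : set (R * R), measurable A ->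
    pushforward P (fun w => B t w - B s w) A = planar_gaussian (t - s) A.

(* Time is [0, +oo[: the values B t with t < 0 play no role. *)
Record planar_brownian_motion (z : R * R) : Prop := PlanarBrownianMotion {
  bm_measurable : forall t, 0 <= t -> measurable_fun setT (B t);
  bm_start : {ae P, forall w, B 0 w = z};
  bm_independent : independent_increments;
  bm_gaussian : gaussian_increments;
  bm_continuous :
    {ae P, forall w, {within `[0, +oo[, continuous (fun t => B t w)}} }.

End planar_brownian_motion.

(* The infimum is taken in \bar R, so that it is +oo for a path that never
   reaches the circle. *)
Definition exit_time (R : realType) (z : R * R) (delta : R) (p : R -> R * R) :
    \bar R :=
  ereal_inf [set t%:E | t in [set t : R | 0 <= t /\ enorm (p t - z) = delta]].

(* The real interval [0, T]; it is [0, +oo[ when T = +oo. *)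
Definition time_interval (R : realType) (T : \bar R) : set R :=
  [set t | 0 <= t /\ (t%:E <= T)%E].

(* Taken in \bar R, the supremum is the maximum when I is compact and f and g
   are continuous on I, and it is +oo when |f - g| is unbounded on I. *)
Definition sup_dist (R : realType) (I : set R) (f g : R -> R * R) : \bar R :=
  ereal_sup [set (enorm (f t - g t))%:E | t in I].

(* Main.v *)
Require Import Defs.
From mathcomp Require Import all_boot all_order all_algebra.
From mathcomp Require Import all_classical all_reals all_analysis.
From mathcomp Require Import measurable_realfun.
From mathcomp Require Import ring lra.

Set Implicit Arguments.
Unset Strict Implicit.
Unset Printing Implicit Defensive.

Import Order.TTheory GRing.Theory Num.Theory.
Import numFieldNormedType.Exports.
Local Open Scope classical_set_scope.
Local Open Scope ring_scope.

(* Suppose that, at some scale r, the path crosses lengthwise the four sides of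
   the square annulus r < |x - z| < 3 r, with room to spare.  A path b close to it
   makes the same crossings, and the points that can be joined to z by a polygonal
   line avoiding them form the neighborhood V: such a line cannot leave the outer
   square, by a parity argument in the side through which it would leave.

   It remains to see that almost surely this happens at some scale r <= delta / 10.
   Trials are made at finitely many scales, in disjoint time windows, the window of
   scale r having length 8 r^2 and starting at a time much smaller than r^2.  In a
   window split into n steps, all increments are r / 8n-close to those of a fixed
   polygonal curve with probability p >= (c / n)^n.  Given this, a union bound over
   dyadic increments shows that the path oscillates too much within some step with
   probability O(1 / n) only: replacing the constraint on one step by a large
   deviation on a subinterval costs a factor O(n h^3 / r^6) with h = 8 r^2 / n, and
   there are n steps.  Only the first successful trial is looked at, so the failure
   probability is at most (1 - p)^M + O(1 / n) + o(1) after M trials. *)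

(** * Crossings of a strip *)

Section crossing.
Context {R : realType}.
Local Notation plane := (R * R)%type.
Implicit Types (p q x y z : plane) (S K : set plane).

Definition aligned p q : Prop := p.1 = q.1 \/ p.2 = q.2.

Definition between (a b x : R) : bool := (a <= x <= b) || (b <= x <= a).

Definition box p q : set plane :=
  [set x | between p.1 q.1 x.1 && between p.2 q.2 x.2].

(* Polygonal lines from z with horizontal and vertical edges: the box of an
   aligned pair is the segment between them. *)
Inductive reach S K z : plane -> Prop :=
| reach_refl : reach S K z z
| reach_step p q : reach S K z p -> S q -> aligned p q ->
    (forall x, box p q x -> ~ K x) -> reach S K z q.

(** For a vertical edge: does the half-line going left from [x] meet it? Testing both ends by the
    same strict inequality counts a vertex shared by two edges consistently. On a horizontal edge
    the two tests agree and the value is [false]. *)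
Definition left_cross p q x : bool :=
  (p.1 < x.1) && ((x.2 < p.2) (+) (x.2 < q.2)).

(** The contribution of the vertex [p] to the change of parity when the point moves from [x] to a
    nearby [y]. *)
Definition height_jump x y p : bool :=
  (p.1 < x.1) && ((x.2 < p.2) (+) (y.2 < p.2)).

Lemma near_lt_fst a x : a != x.1 -> \forall y \near x, (a < y.1) = (a < x.1).
Proof.
move=> ax; have cf : y.1 @[y --> x] --> x.1 by exact: cvg_fst.
have [ltax|ltxa|eax] := ltgtP a x.1; last by rewrite eax eqxx in ax.
- by near=> y; near: y; exact: (cvgr_gt x.1 cf).
- near=> y; apply/negbTE; rewrite -leNgt ltW//.
  by near: y; exact: (cvgr_lt x.1 cf).
Unshelve. all: by end_near. Qed.

Lemma near_lt_snd a x : a != x.2 -> \forall y \near x, (y.2 < a) = (x.2 < a).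
Proof.
move=> ax; have cf : y.2 @[y --> x] --> x.2 by exact: cvg_snd.
have [ltax|ltxa|eax] := ltgtP a x.2; last by rewrite eax eqxx in ax.
- near=> y; apply/negbTE; rewrite -leNgt ltW//.
  by near: y; exact: (cvgr_gt x.2 cf).
- by near=> y; near: y; exact: (cvgr_lt x.2 cf).
Unshelve. all: by end_near. Qed.

(** On a vertical edge, either the abscissa test is locally constant, or [x] is in line with the
    edge, hence strictly above or below both ends, and the height tests are. On a horizontal edge
    [left_cross] vanishes and the two jumps cancel: either no jump occurs near [x], or [x], level
    with the edge but off it, has both ends on the same side. *)
Lemma left_cross_near p q x : aligned p q -> ~ box p q x ->
  \forall y \near x, left_cross p q y (+) left_cross p q x =
    height_jump x y p (+) height_jump x y q.
Proof.
rewrite /box/= /between /left_cross /height_jump => -[e|e]; rewrite e => xpq.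
- have [ex|nx] := eqVneq q.1 x.1.
    have [[h1 h2]|[h1 h2]] : (x.2 < p.2 /\ x.2 < q.2) \/ (p.2 < x.2 /\ q.2 < x.2).
      move: xpq; rewrite ex lexx/= => H.
      case: (ltP x.2 p.2) => h1; case: (ltP x.2 q.2) => h2; first by left.
      + by exfalso; apply: H; apply/orP; right; lra.
      + by exfalso; apply: H; apply/orP; left; lra.
      + right; rewrite !lt_neqAle h1 h2 !andbT; split; apply/eqP => h;
          apply: H; apply/orP; lra.
    + near=> y.
      have -> : (y.2 < p.2) = (x.2 < p.2) by near: y; apply: near_lt_snd; rewrite gt_eqF.
      have -> : (y.2 < q.2) = (x.2 < q.2) by near: y; apply: near_lt_snd; rewrite gt_eqF.
      by rewrite h1 h2 !addbb !andbF.
    + near=> y.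
      have -> : (y.2 < p.2) = (x.2 < p.2) by near: y; apply: near_lt_snd; rewrite lt_eqF.
      have -> : (y.2 < q.2) = (x.2 < q.2) by near: y; apply: near_lt_snd; rewrite lt_eqF.
      by rewrite !(ltNge x.2) !ltW// !addbb !andbF.
  near=> y.
  have -> : (q.1 < y.1) = (q.1 < x.1) by near: y; exact: near_lt_fst.
  by case: (q.1 < x.1); case: (x.2 < p.2); case: (x.2 < q.2);
    case: (y.2 < p.2); case: (y.2 < q.2).
- have [ex|nx] := eqVneq q.2 x.2; last first.
    near=> y.
    have -> : (y.2 < q.2) = (x.2 < q.2) by near: y; exact: near_lt_snd.
    by rewrite !addbb !andbF.
  have <- : (p.1 < x.1) = (q.1 < x.1).
    move: xpq; rewrite ex lexx/= andbT.
    by case: (ltP p.1 x.1) => ?; case: (ltP q.1 x.1) => ? // H;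
      exfalso; apply: H; apply/orP; lra.
  by near=> y; rewrite !addbb !andbF.
Unshelve. all: by end_near. Qed.

(* F y is the parity of the number of vertical edges met by the horizontal
   half-line going left from y.  When y moves, the changes caused by the two edges
   at an inner vertex cancel, so that only the endpoints of the line matter. *)
Lemma reach_parity S K z x (l1 l2 : R) :
  (forall p, S p -> l1 <= p.1 <= l2) -> S z -> reach S K z x ->
  S x /\ exists F : plane -> bool,
    [/\ forall p, K p -> \forall y \near p,
          F y (+) F p = height_jump p y z (+) height_jump p y x,
        forall p, p.1 < l1 -> F p = false &
        forall p, l2 < p.1 -> F p = (p.2 < z.2) (+) (p.2 < x.2)].
Proof.
move=> Sl Sz; elim=> [|p q _ [Sp [F [F1 F2 F3]]] Sq pq pqK].
  split=> //; exists (fun=> false); split=> // p => [_|_].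
    by near=> y; rewrite !addbb.
  by rewrite addbb.
split=> //; exists (fun y => F y (+) left_cross p q y); split.
- move=> x0 Kx0; near=> y.
  have -> : F y (+) left_cross p q y (+) (F x0 (+) left_cross p q x0) =
      (F y (+) F x0) (+) (left_cross p q y (+) left_cross p q x0).
    by rewrite -!addbA; congr addb; rewrite addbCA.
  have -> : F y (+) F x0 = height_jump x0 y z (+) height_jump x0 y p.
    by near: y; exact: F1.
  have -> : left_cross p q y (+) left_cross p q x0 =
      height_jump x0 y p (+) height_jump x0 y q.
    by near: y; apply: left_cross_near => // /pqK.
  by rewrite -addbA (addbA (height_jump x0 y p)) addbb addFb.
- move=> x0 x0l; rewrite F2// /left_cross addFb.
  have /andP[lp _] := Sl _ Sp.
  by rewrite ltNge (le_trans (ltW x0l))//.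
- move=> x0 x0l; rewrite F3// /left_cross.
  have /andP[_ lp] := Sl _ Sp.
  by rewrite (le_lt_trans lp)//= -addbA (addbA (x0.2 < p.2)) addbb addFb.
Unshelve. all: by end_near. Qed.

(** The times [s1] and [s2] are not ordered, so a curve run from right to left counts as well. *)
Definition crossing K (l1 l2 a b : R) : Prop :=
  exists (c : R -> plane) (t1 t2 s1 s2 : R),
    [/\ {within `[t1, t2], continuous c}, t1 <= s1 <= t2, t1 <= s2 <= t2,
        forall t, t1 <= t <= t2 -> K (c t) /\ a < (c t).2 < b &
        (c s1).1 < l1 /\ l2 < (c s2).1].

(** If [x] were above the strip, no point of the crossing curve would be level with [z] or [x], so
    both jumps would vanish and the parity would be constant along the curve. But it is even left of
    [l1] and odd right of [l2]. *)
Lemma crossing_blocks S K z x l1 l2 a b :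
  (forall p, S p -> l1 <= p.1 <= l2) -> S z -> reach S K z x ->
  crossing K l1 l2 a b -> z.2 <= a -> x.2 < b.
Proof.
move=> Sl Sz zx [c [t1 [t2 [s1 [s2 [cc s1t s2t cK [c1 c2]]]]]]] za.
rewrite ltNge; apply/negP => bx.
have [_ [F [F1 F2 F3]]] := reach_parity Sl Sz zx.
(* The parity is made real-valued: a continuous function taking only the values 0 and 1 contradicts
   the intermediate value theorem at 1/2. *)
pose g t : R := (F (c t))%:R.
have cg : {within `[t1, t2], continuous g}.
  apply/subspace_continuousP => t /=; rewrite in_itv/= => tt.
  have /subspace_continuousP/(_ t) := cc.
  rewrite /= in_itv/= => /(_ tt) ct.
  have [Kc /andP[ac cb]] := cK _ tt.
  apply: cvg_near_cst.
  have : \forall y \near c t, F y = F (c t).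
    near=> y.
    have : F y (+) F (c t) = height_jump (c t) y z (+) height_jump (c t) y x.
      by near: y; exact: F1.
    rewrite /height_jump.
    have -> : (y.2 < z.2) = ((c t).2 < z.2).
      by near: y; apply: near_lt_snd; rewrite lt_eqF// (le_lt_trans za).
    have -> : (y.2 < x.2) = ((c t).2 < x.2).
      by near: y; apply: near_lt_snd; rewrite gt_eqF// (lt_le_trans cb).
    by rewrite !addbb !andbF; case: (F y); case: (F (c t)).
  move=> /ct; rewrite /prop_near1 /fmap /within /=.
  apply: (@filterS _ (nbhs t)) => u /= e ut.
  by rewrite /from_subspace /g; rewrite /from_subspace in e; rewrite e.
have g1 : g s1 = 0 by rewrite /g F2.
have g2 : g s2 = 1.
  rewrite /g F3//; have [_ /andP[ac cb]] := cK _ s2t.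
  by rewrite (lt_le_trans cb bx) ltNge (le_trans za (ltW ac)).
have t12 : t1 <= t2 by lra.
have sub u v : t1 <= u <= t2 -> t1 <= v <= t2 -> u <= v ->
    {within `[u, v], continuous g}.
  move=> ut vt uv; apply: continuous_subspaceW cg.
  by apply: subset_itv; rewrite ?bnd_simp; lra.
have half : exists t, g t = 2^-1.
  have [s12|s21] := leP s1 s2.
    have [|t _ gt] := IVT s12 (sub _ _ s1t s2t s12) (v := 2^-1).
      by rewrite g1 g2 ge_min le_max; lra.
    by exists t.
  have [|t _ gt] := IVT (ltW s21) (sub _ _ s2t s1t (ltW s21)) (v := 2^-1).
    by rewrite g1 g2 ge_min le_max; lra.
  by exists t.
have [t] := half; rewrite /g; case: (F (c t)) => /=; lra.
Unshelve. all: by end_near. Qed.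

End crossing.

(** * From four crossings to a bounded neighborhood *)

Section enclosure.
Context {R : realType}.
Local Notation plane := (R * R)%type.
Implicit Types (p q x y z : plane) (S K : set plane).

Lemma ball_planeP x y (e : R) :
  ball x e y <-> `|x.1 - y.1| < e /\ `|x.2 - y.2| < e.
Proof. by split=> -[]. Qed.

Lemma nbhs_planeP x (A : set plane) : nbhs x A <->
  exists2 e : R, 0 < e & forall y, `|x.1 - y.1| < e -> `|x.2 - y.2| < e -> A y.
Proof.
split=> [/nbhs_ballP[e /= e0 eA]|[e e0 eA]].
  by exists e => // y h1 h2; apply: eA; apply/ball_planeP.
by apply/nbhs_ballP; exists e => // y /ball_planeP[h1 h2]; exact: eA.
Qed.

Lemma reach_preimage (f : plane -> plane) S K z x : involutive f ->
  (forall p q, aligned p q -> aligned (f p) (f q)) ->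
  (forall p q y, box (f p) (f q) y -> box p q (f y)) ->
  reach S K z x -> reach (f @^-1` S) (f @^-1` K) (f z) (f x).
Proof.
move=> ff fa fb; elim=> [|p q _ IH Sq pq pqK]; first exact: reach_refl.
apply: (reach_step IH); first by rewrite /preimage/= ff.
  exact: fa.
by move=> y /fb /pqK.
Qed.

(** The three reflections below carry the bottom, right and left sides of the square to the top one,
    the only side treated by [crossing_blocks]. *)
Definition flip x : plane := (x.1, - x.2).
Definition swap x : plane := (x.2, x.1).
Definition antiswap x : plane := (- x.2, - x.1).

Lemma between_opp (a b c : R) : between (- a) (- b) c = between a b (- c).
Proof. by rewrite /between; apply/idP/idP => /orP[] h; apply/orP; lra. Qed.

Lemma crossing_below (f : plane -> plane) S K z x l1 l2 a b : involutive f ->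
  (forall p q, aligned p q -> aligned (f p) (f q)) ->
  (forall p q y, box (f p) (f q) y -> box p q (f y)) ->
  (forall p, S p -> l1 <= (f p).1 <= l2) -> S z -> reach S K z x ->
  crossing (f @^-1` K) l1 l2 a b -> (f z).2 <= a -> (f x).2 < b.
Proof.
move=> ff fa fb Sl Sz zx cr za.
apply: (crossing_blocks _ _ (reach_preimage ff fa fb zx) cr za).
- by move=> p /Sl; rewrite ff.
- by rewrite /preimage/= ff.
Qed.

Lemma encircled_nbhs K z (r : R) : 0 < r -> closed K -> ~ K z ->
  crossing K (z.1 - 3 * r) (z.1 + 3 * r) (z.2 + r) (z.2 + 3 * r) ->
  crossing (flip @^-1` K) (z.1 - 3 * r) (z.1 + 3 * r) (- z.2 + r) (- z.2 + 3 * r) ->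
  crossing (swap @^-1` K) (z.2 - 3 * r) (z.2 + 3 * r) (z.1 + r) (z.1 + 3 * r) ->
  crossing (antiswap @^-1` K) (- z.2 - 3 * r) (- z.2 + 3 * r) (- z.1 + r) (- z.1 + 3 * r) ->
  exists V : set plane, [/\ open V, bounded_set V, V z & boundary V `<=` K].
Proof.
move=> r0 cK Kz top bottom right left.
(* The polygonal lines are confined to this closed square from the outset; [interior_square] then
   shows that they never touch its sides, so that the confinement creates no boundary. *)
pose S : set plane := [set p | `|p.1 - z.1| <= 3 * r /\ `|p.2 - z.2| <= 3 * r].
have Sz : S z by rewrite /S/= !subrr normr0; lra.
have SP p : S p -> (z.1 - 3 * r <= p.1 <= z.1 + 3 * r) /\
                   (z.2 - 3 * r <= p.2 <= z.2 + 3 * r).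
  by move=> [/ler_normlP[h1 h2] /ler_normlP[h3 h4]]; split; lra.
pose V := reach S K z.
have VS x : V x -> S x by case.
have nK x : V x -> ~ K x.
  case=> // p q _ _ _; apply; rewrite /box/= /between !lexx/= !andbT.
  by rewrite !le_total.
have interior_square x : V x -> `|x.1 - z.1| < 3 * r /\ `|x.2 - z.2| < 3 * r.
  move=> Vx; rewrite !ltr_norml.
  have h1 : x.2 < z.2 + 3 * r.
    apply: (@crossing_below id S K z x _ _ _ _ _ _ _ _ Sz Vx top) => //=; last lra.
    by move=> p /SP[].
  have h2 : (flip x).2 < - z.2 + 3 * r.
    apply: (@crossing_below flip S K z x _ _ _ _ _ _ _ _ Sz Vx bottom) => //=.
    - by move=> p; rewrite /flip/= opprK -surjective_pairing.
    - by move=> p q [e|e]; [left|right]; rewrite /= e.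
    - by move=> p q y; rewrite /box/= between_opp.
    - by move=> p /SP[].
    - lra.
  have h3 : (swap x).2 < z.1 + 3 * r.
    apply: (@crossing_below swap S K z x _ _ _ _ _ _ _ _ Sz Vx right) => //=.
    - by move=> p; rewrite /swap/= -surjective_pairing.
    - by move=> p q [e|e]; [right|left].
    - by move=> p q y; rewrite /box/= andbC.
    - by move=> p /SP[].
    - lra.
  have h4 : (antiswap x).2 < - z.1 + 3 * r.
    apply: (@crossing_below antiswap S K z x _ _ _ _ _ _ _ _ Sz Vx left) => //=.
    - by move=> p; rewrite /antiswap/= !opprK -surjective_pairing.
    - by move=> p q [e|e]; [right|left]; rewrite /= e.
    - by move=> p q y; rewrite /box/= andbC !between_opp.
    - by move=> p /SP[_ ?]; lra.
    - lra.
  by move: h2 h3 h4; rewrite /flip /swap /antiswap/=; split; apply/andP; split; lra.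
(* Two points are joined through the corner [(x.1, y.2)]: both edges lie in the box of [x] and
   [y]. *)
have extend x y : V x -> S y -> (forall u, box x y u -> ~ K u) -> V y.
  move=> Vx Sy xy.
  have [Sx1 Sx2] := VS _ Vx; have [Sy1 Sy2] := Sy.
  have Vc : V (x.1, y.2).
    apply: (reach_step Vx) => //=; first by left.
    move=> u /andP[/= u1 u2]; apply: xy; rewrite /box/= u2 andbT.
    by move: u1; rewrite /between => /orP[]/andP[? ?]; apply/orP; lra.
  apply: (reach_step Vc) => //=; first by right.
  move=> u /andP[/= u1 u2]; apply: xy; rewrite /box/= u1/=.
  by move: u2; rewrite /between => /orP[]/andP[? ?]; apply/orP; lra.
have away x : ~ K x -> exists2 e : R, 0 < e &
    forall y, `|x.1 - y.1| < e -> `|x.2 - y.2| < e -> ~ K y.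
  move=> Kx; apply/nbhs_planeP/open_nbhs_nbhs; split=> //.
  exact: closed_openC.
have small x y u (e : R) : `|x.1 - y.1| < e -> `|x.2 - y.2| < e ->
    box x y u \/ box y x u -> `|x.1 - u.1| < e /\ `|x.2 - u.2| < e.
  rewrite !ltr_norml => /andP[? ?] /andP[? ?] h.
  have {h} /andP[h1 h2] : box x y u.
    by case: h => // /andP[h1 h2]; apply/andP; split; rewrite /between orbC.
  move: h1 h2; rewrite /between.
  by move=> /orP[]/andP[? ?] /orP[]/andP[? ?]; split; apply/andP; split; lra.
have Vopen : open V.
  rewrite openE => x Vx; apply/nbhs_planeP.
  have [e e0 eK] := away _ (nK _ Vx).
  have [x1 x2] := interior_square _ Vx.
  pose d := Num.min e (Num.min (3 * r - `|x.1 - z.1|) (3 * r - `|x.2 - z.2|)).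
  exists d; first by rewrite /d !lt_min e0 !subr_gt0 x1 x2.
  move=> y; rewrite /d !lt_min => /andP[h1 /andP[h2 _]] /andP[h3 /andP[_ h4]].
  apply: (extend x y Vx).
    split.
      have := ler_distD x.1 y.1 z.1; rewrite (distrC y.1 x.1); lra.
    have := ler_distD x.2 y.2 z.2; rewrite (distrC y.2 x.2); lra.
  move=> u xyu; have [] := small _ _ _ _ h1 h3 (or_introl xyu).
  exact: eK.
exists V; split => //; last 1 first.
(* A point of the closure lies in the closed square; if it is off [K], a small box avoiding [K]
   joins it to a point of [V], so it belongs to the open set [V]. *)
- move=> x [clx]; apply: contra_notP => Kx; apply: (Vopen : V `<=` interior V).
  have [e e0 eK] := away _ Kx.
  have Vnear d : 0 < d -> exists y, [/\ V y, `|x.1 - y.1| < d & `|x.2 - y.2| < d].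
    move=> d0; have [|y [Vy [y1 y2]]] :=
      clx [set y | `|x.1 - y.1| < d /\ `|x.2 - y.2| < d].
      by apply/nbhs_planeP; exists d.
    by exists y.
  have Sx : S x.
    split; apply/ler_addgt0Pr => d d0;
      have [y [/VS[y1 y2] h1 h2]] := Vnear _ d0.
      have := ler_distD y.1 x.1 z.1; lra.
    have := ler_distD y.2 x.2 z.2; lra.
  have [y [Vy h1 h2]] := Vnear _ e0.
  apply: (extend y x Vy Sx) => u yxu.
  by have [] := small _ _ _ _ h1 h2 (or_intror yxu); exact: eK.
- exists (`|z| + 3 * r); split; first exact: num_real.
  move=> M zM x /VS[x1 x2]; apply: ltW; apply: le_lt_trans zM.
  rewrite -lerBlDl; apply: le_trans (lerB_dist _ _) _.
  by rewrite prod_normE/= ge_max x1 x2.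
- exact: reach_refl.
Qed.

End enclosure.

(** * A curve crossing the four sides of an annulus *)

Section curve.
Context {R : realType}.
Local Notation plane := (R * R)%type.

Definition ramp (j t : R) : R := Num.max 0 (Num.min 1 (t - j)).

Lemma ramp_before j t : t <= j -> ramp j t = 0.
Proof. by move=> tj; rewrite /ramp min_r ?max_l; lra. Qed.

Lemma ramp_after j t : j + 1 <= t -> ramp j t = 1.
Proof. by move=> tj; rewrite /ramp min_l ?max_r; lra. Qed.

Lemma ramp_during j t : j <= t <= j + 1 -> ramp j t = t - j.
Proof. by move=> tj; rewrite /ramp min_r ?max_r; lra. Qed.

Lemma ramp_lipschitz j s t : s <= t -> 0 <= ramp j t - ramp j s <= t - s.
Proof.
move=> st.
have [tj|jt] := leP t j; first by rewrite !ramp_before; lra.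
have [tj1|j1t] := leP t (j + 1); have [sj|js] := leP s j.
- by rewrite (ramp_before sj) ramp_during; lra.
- by rewrite !ramp_during; lra.
- by rewrite (ramp_before sj) ramp_after; lra.
- have [sj1|j1s] := leP s (j + 1).
    by rewrite ramp_after ?(@ramp_during _ s); lra.
  by rewrite !ramp_after; lra.
Qed.

(* The polygonal line through 0, (-4, 2), (4, 2), (2, 4), (2, -4), (4, -2),
   (-4, -2), (-2, -4), (-2, 4), one unit of time per edge: its four long edges
   cross the four sides of the square annulus 1 < |x| < 3. *)
Definition curve (t : R) : plane :=
  (- 4 * ramp 0 t + 8 * ramp 1 t - 2 * ramp 2 t + 2 * ramp 4 t
     - 8 * ramp 5 t + 2 * ramp 6 t,
   2 * ramp 0 t + 2 * ramp 2 t - 8 * ramp 3 t + 2 * ramp 4 t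
     - 2 * ramp 6 t + 8 * ramp 7 t).

Ltac eval_ramp := repeat match goal with |- context [ramp ?j ?t] =>
  first [ rewrite (@ramp_before j t); [|lra] | rewrite (@ramp_after j t); [|lra]
        | rewrite (@ramp_during j t); [|lra] ] end.

Lemma curve_edges t :
  [/\ 0 <= t <= 1 -> curve t = (- 4 * t, 2 * t),
      1 <= t <= 2 -> curve t = (- 4 + 8 * (t - 1), 2),
      2 <= t <= 3 -> curve t = (4 - 2 * (t - 2), 2 + 2 * (t - 2)) &
      3 <= t <= 4 -> curve t = (2, 4 - 8 * (t - 3))] /\
  [/\ 4 <= t <= 5 -> curve t = (2 + 2 * (t - 4), - 4 + 2 * (t - 4)),
      5 <= t <= 6 -> curve t = (4 - 8 * (t - 5), - 2),
      6 <= t <= 7 -> curve t = (- 4 + 2 * (t - 6), - 2 - 2 * (t - 6)) &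
      7 <= t <= 8 -> curve t = (- 2, - 4 + 8 * (t - 7))].
Proof. by split; split=> ?; rewrite /curve; congr pair; eval_ramp; lra. Qed.

Lemma curve_corners :
  [/\ curve 1 = (- 4, 2), curve 2 = (4, 2), curve 3 = (2, 4) & curve 4 = (2, - 4)] /\
  [/\ curve 5 = (4, - 2), curve 6 = (- 4, - 2), curve 7 = (- 2, - 4) &
     curve 8 = (- 2, 4)].
Proof. by split; split; rewrite /curve; congr pair; eval_ramp; lra. Qed.

Lemma edge_cases (t : R) : 0 <= t <= 8 ->
  [\/ 0 <= t <= 1, 1 <= t <= 2, 2 <= t <= 3 | 3 <= t <= 4] \/
  [\/ 4 <= t <= 5, 5 <= t <= 6, 6 <= t <= 7 | 7 <= t <= 8].
Proof.
move=> t08; have [t4|t4] := leP t 4; [left|right].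
  have [?|?] := leP t 1; first by apply: Or41; lra.
  have [?|?] := leP t 2; first by apply: Or42; lra.
  by have [?|?] := leP t 3; [apply: Or43|apply: Or44]; lra.
have [?|?] := leP t 5; first by apply: Or41; lra.
have [?|?] := leP t 6; first by apply: Or42; lra.
by have [?|?] := leP t 7; [apply: Or43|apply: Or44]; lra.
Qed.

Lemma curve_bounded t : 0 <= t <= 8 ->
  - 4 <= (curve t).1 <= 4 /\ - 4 <= (curve t).2 <= 4.
Proof.
have [[c0 c1 c2 c3] [c4 c5 c6 c7]] := curve_edges t.
move=> t08; case: (edge_cases t08) => -[] tj; [rewrite c0//|rewrite c1//|rewrite c2//|rewrite c3//
  |rewrite c4//|rewrite c5//|rewrite c6//|rewrite c7//]; rewrite /=; split; lra.
Qed.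

(** Only the first edge comes near the origin; the later ones are used to build a set [K] avoiding
    [z]. *)
Lemma curve_away t : 1 <= t <= 8 ->
  [\/ 2 <= (curve t).1, (curve t).1 <= - 2, 2 <= (curve t).2 | (curve t).2 <= - 2].
Proof.
have [[c0 c1 c2 c3] [c4 c5 c6 c7]] := curve_edges t.
move=> t18; have t08 : 0 <= t <= 8 by lra.
case: (edge_cases t08) => -[] tj.
- by rewrite c0//; apply: Or42; rewrite /=; lra.
- by rewrite c1//; apply: Or43.
- by rewrite c2//; apply: Or43; rewrite /=; lra.
- by rewrite c3//; apply: Or41.
- by rewrite c4//; apply: Or41; rewrite /=; lra.
- by rewrite c5//; apply: Or44.
- by rewrite c6//; apply: Or44; rewrite /=; lra.
- by rewrite c7//; apply: Or42.
Qed.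

(** The absolute values of the coefficients of the ramps add up to 26 in the first coordinate and to
    24 in the second. *)
Lemma curve_lipschitz s t : s <= t ->
  `|(curve t).1 - (curve s).1| <= 26 * (t - s) /\
  `|(curve t).2 - (curve s).2| <= 26 * (t - s).
Proof.
move=> st.
have h0 := ramp_lipschitz 0 st; have h1 := ramp_lipschitz 1 st.
have h2 := ramp_lipschitz 2 st; have h3 := ramp_lipschitz 3 st.
have h4 := ramp_lipschitz 4 st; have h5 := ramp_lipschitz 5 st.
have h6 := ramp_lipschitz 6 st; have h7 := ramp_lipschitz 7 st.
by rewrite /curve/= !ler_norml; split; apply/andP; split; lra.
Qed.

Lemma normr_le_enorm (x : plane) : `|x.1| <= enorm x /\ `|x.2| <= enorm x.
Proof.
by split; rewrite /enorm -sqrtr_sqr ler_wsqrtr// (lerDl, lerDr) sqr_ge0.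
Qed.

Lemma enorm_le (x : plane) : enorm x <= `|x.1| + `|x.2|.
Proof.
rewrite /enorm -[leRHS]ger0_norm ?addr_ge0// -[leRHS]sqrtr_sqr ler_wsqrtr//.
rewrite sqrrD !real_normK ?num_real//.
by rewrite addrAC lerDl mulrn_wge0// mulr_ge0.
Qed.

End curve.

(** * Paths close to the curve enclose the starting point *)

Section curve.
Context {R : realType}.
Local Notation plane := (R * R)%type.

Lemma flip_continuous : continuous (@flip R).
Proof.
move=> x; have h1 : y.1 @[y --> x] --> x.1 by exact: cvg_fst.
have h2 : - y.2 @[y --> x] --> - x.2 by apply: cvgN; exact: cvg_snd.
exact: cvg_pair h1 h2.
Qed.

Lemma swap_continuous : continuous (@swap R).
Proof.
move=> x; have h1 : y.1 @[y --> x] --> x.1 by exact: cvg_fst.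
have h2 : y.2 @[y --> x] --> x.2 by exact: cvg_snd.
exact: cvg_pair h2 h1.
Qed.

Lemma antiswap_continuous : continuous (@antiswap R).
Proof.
move=> x; have h1 : - y.1 @[y --> x] --> - x.1 by apply: cvgN; exact: cvg_fst.
have h2 : - y.2 @[y --> x] --> - x.2 by apply: cvgN; exact: cvg_snd.
exact: cvg_pair h2 h1.
Qed.

(** A path [b] within [r / 4] of [p] is within [3 r / 4] of the scaled curve. The long edges, at
    distance [2 r] from the axes, thus stay strictly between [r] and [3 r], and their ends, at
    [4 r], pass beyond [3 r]. *)
Lemma tube_encircles (p : R -> plane) z (delta r s : R) :
  0 < r -> 10 * r <= delta -> 0 <= s ->
  (forall t, 0 <= t <= s ->
     `|(p t).1 - z.1| <= r / 8 /\ `|(p t).2 - z.2| <= r / 8) ->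
  (forall t, 0 <= t <= 8 ->
     `|(p (s + r ^+ 2 * t)).1 - z.1 - r * (curve t).1| <= r / 2 /\
     `|(p (s + r ^+ 2 * t)).2 - z.2 - r * (curve t).2| <= r / 2) ->
  let I := time_interval (exit_time z delta p) in
  exists eps : R, 0 < eps /\
    forall b : R -> plane, {within I, continuous b} ->
      (sup_dist I b p < eps%:E)%E ->
      exists V : set plane,
        [/\ open V, bounded_set V, V z & boundary V `<=` b @` I].
Proof.
move=> r0 rd s0 pre tube I.
have r20 : 0 < r ^+ 2 by rewrite exprn_gt0.
have rescale t : t = s + r ^+ 2 * ((t - s) / r ^+ 2).
  by rewrite mulrC divfK ?gt_eqF// addrC subrK.
have rescale_in j k t : s + r ^+ 2 * j <= t <= s + r ^+ 2 * k ->
    j <= (t - s) / r ^+ 2 <= k.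
  move=> /andP[h1 h2]; rewrite ler_pdivlMr// ler_pdivrMr//.
  by rewrite !(mulrC _ (r ^+ 2)); lra.
(* In the tube each coordinate of [p t - z] is at most [9 r / 2], so the norm is at most
   [9 r < delta]: the circle is not reached before the window ends. *)
have exit : ((s + r ^+ 2 * 8)%:E <= exit_time z delta p)%E.
  apply: le_ereal_inf_tmp => _ [t [t0 te] <-]; rewrite lee_fin leNgt.
  apply/negP => tT; suff : enorm (p t - z) < delta by lra.
  apply: le_lt_trans (enorm_le _) _; rewrite /=.
  have [ts|st] := leP t s; first by have [] := pre t _; lra.
  have [] := tube ((t - s) / r ^+ 2) _.
    by apply: rescale_in; lra.
  have [] := @curve_bounded R ((t - s) / r ^+ 2) _.
    by apply: rescale_in; lra.
  rewrite -rescale => /andP[c1 c2] /andP[c3 c4].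
  set c := curve _ in c1 c2 c3 c4 *.
  have d1 : - (4 * r) <= r * c.1 <= 4 * r by nra.
  have d2 : - (4 * r) <= r * c.2 <= 4 * r by nra.
  move=> /ler_normlP[e1 e2] /ler_normlP[e3 e4].
  have f1 : `|(p t).1 - z.1| <= 4 * r + r / 2 by rewrite ler_norml; lra.
  have f2 : `|(p t).2 - z.2| <= 4 * r + r / 2 by rewrite ler_norml; lra.
  by move: f1 f2; clear - r0 rd; lra.
have IT t : 0 <= t <= s + r ^+ 2 * 8 -> I t.
  move=> /andP[t0 tT]; split=> //.
  by apply: le_trans exit; rewrite lee_fin.
exists (r / 4); split; first lra.
move=> b cb bp.
have bclose t : I t -> `|(b t).1 - (p t).1| < r / 4 /\ `|(b t).2 - (p t).2| < r / 4.
  move=> It; have : enorm (b t - p t) < r / 4.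
    by rewrite -lte_fin; apply: le_lt_trans bp; apply: ereal_sup_ubound; exists t.
  by have [] := normr_le_enorm (b t - p t); rewrite /=; lra.
have btube t : 0 <= t <= 8 ->
    `|(b (s + r ^+ 2 * t)).1 - z.1 - r * (curve t).1| < 3 / 4 * r /\
    `|(b (s + r ^+ 2 * t)).2 - z.2 - r * (curve t).2| < 3 / 4 * r.
  move=> t8; have [p1 p2] := tube _ t8.
  have [|q1 q2] := bclose (s + r ^+ 2 * t); first by apply: IT; nra.
  move: p1 p2 q1 q2; rewrite !ler_norml !ltr_norml; clear - r0.
  by move=> /andP[? ?] /andP[? ?] /andP[? ?] /andP[? ?]; split; apply/andP; split; lra.
(* The first edge, which leaves from the center, is cut off so that [K] avoids [z]. *)
pose J := `[s + r ^+ 2 * 1, s + r ^+ 2 * 8]%classic.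
have JI : J `<=` I.
  by move=> t; rewrite /J/= in_itv/= => h; apply: IT; clear - h r20 s0; nra.
have cbJ : {within J, continuous b} by apply: continuous_subspaceW cb.
pose K := b @` J.
have cK : closed K.
  apply: compact_closed; first exact: norm_hausdorff.
  by apply: continuous_compact => //; exact: segment_compact.
have Kz : ~ K z.
  move=> [t]; rewrite /J/= in_itv/= => tJ bt.
  have tt := rescale_in _ _ _ tJ.
  have [] := btube ((t - s) / r ^+ 2) _; first by clear - tt; lra.
  rewrite -rescale bt !subrr !sub0r !normrN !ltr_norml.
  move=> /andP[? ?] /andP[? ?].
  by have [] := curve_away tt => ?; clear rescale_in; nra.
have cross (f : plane -> plane) j k l1 l2 a c s1 s2 : involutive f -> continuous f ->
    1 <= j -> k <= 8 -> j <= s1 <= k -> j <= s2 <= k ->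
    (forall t, j <= t <= k -> a < (f (b (s + r ^+ 2 * t))).2 < c) ->
    (f (b (s + r ^+ 2 * s1))).1 < l1 -> l2 < (f (b (s + r ^+ 2 * s2))).1 ->
    crossing (f @^-1` K) l1 l2 a c.
  move=> ff cf j1 k8 s1jk s2jk fac f1 f2.
  have sub t : s + r ^+ 2 * j <= t <= s + r ^+ 2 * k -> J t.
    by rewrite /J/= in_itv/=; clear - j1 k8 r20; nra.
  exists (f \o b), (s + r ^+ 2 * j), (s + r ^+ 2 * k),
    (s + r ^+ 2 * s1), (s + r ^+ 2 * s2); split => //.
  - apply: (@continuous_subspaceW _ _ _ J).
      by move=> t; rewrite /= in_itv/=; exact: sub.
    apply/subspace_continuousP => t Jt; apply: (@cvg_comp _ _ _ b f); last exact: cf.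
    by move/subspace_continuousP : cbJ => /(_ _ Jt).
  - by clear - s1jk r20; nra.
  - by clear - s2jk r20; nra.
  - move=> t tjk; split; first by rewrite /preimage/= ff; exists t => //; exact: sub.
    by rewrite [t]rescale; apply/fac/rescale_in.
have at_edge t u v : 0 <= t <= 8 -> curve t = (u, v) ->
    - (3 / 4 * r) < (b (s + r ^+ 2 * t)).1 - z.1 - r * u < 3 / 4 * r /\
    - (3 / 4 * r) < (b (s + r ^+ 2 * t)).2 - z.2 - r * v < 3 / 4 * r.
  by move=> /btube[] + + ct; rewrite ct/= !ltr_norml.
have [V [oV bV Vz VK]] : exists V : set plane,
    [/\ open V, bounded_set V, V z & boundary V `<=` K].
  clear - r0 cK Kz cross at_edge.
  have [[c1 c2 c3 c4] [c5 c6 c7 c8]] := @curve_corners R.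
  apply: (@encircled_nbhs R K z r) => //.
  - apply: (cross id 1 2 _ _ _ _ 1 2) => //; try lra.
    + by move=> x; exact: cvg_id.
    + by move=> t t12; have [[_ /(_ t12) ct _ _] _] := curve_edges t;
        have [|_] := at_edge _ _ _ _ ct; lra.
    + by have [|] := at_edge _ _ _ _ c1; lra.
    + by have [|] := at_edge _ _ _ _ c2; lra.
  (* This edge runs from right to left, whence the times 6 and 5 in this order; the next two sides
     are likewise reversed after reflection. *)
  - apply: (cross (@flip R) 5 6 _ _ _ _ 6 5) => //; try lra.
    + by move=> x; rewrite /flip/= opprK -surjective_pairing.
    + exact: flip_continuous.
    + by move=> t t12; have [_ [_ /(_ t12) ct _ _]] := curve_edges t;
        have [|_] := at_edge _ _ _ _ ct; rewrite /flip/=; lra.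
    + by have [|] := at_edge _ _ _ _ c6; rewrite /flip/=; lra.
    + by have [|] := at_edge _ _ _ _ c5; rewrite /flip/=; lra.
  - apply: (cross (@swap R) 3 4 _ _ _ _ 4 3) => //; try lra.
    + by move=> x; rewrite /swap/= -surjective_pairing.
    + exact: swap_continuous.
    + by move=> t t12; have [[_ _ _ /(_ t12) ct] _] := curve_edges t;
        have [|+ _] := at_edge _ _ _ _ ct; rewrite /swap/=; lra.
    + by have [|] := at_edge _ _ _ _ c4; rewrite /swap/=; lra.
    + by have [|] := at_edge _ _ _ _ c3; rewrite /swap/=; lra.
  - apply: (cross (@antiswap R) 7 8 _ _ _ _ 8 7) => //; try lra.
    + by move=> x; rewrite /antiswap/= !opprK -surjective_pairing.
    + exact: antiswap_continuous.
    + by move=> t t12; have [_ [_ _ _ /(_ t12) ct]] := curve_edges t;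
        have [|+ _] := at_edge _ _ _ _ ct; rewrite /antiswap/=; lra.
    + by have [|] := at_edge _ _ _ _ c8; rewrite /antiswap/=; lra.
    + by have [|] := at_edge _ _ _ _ c7; rewrite /antiswap/=; lra.
exists V; split => //; apply: subset_trans VK _.
exact: image_subset.
Qed.
End curve.

(** * Gaussian estimates *)

Section gaussian.
Context {R : realType}.
Local Notation plane := (R * R)%type.

Lemma measurable_normr_gt (x : R) : measurable [set y : R | x < `|y|].
Proof.
rewrite (_ : [set y | _] = setT `&` (Num.norm @^-1` `]x, +oo[)); last first.
  by rewrite setTI; apply/seteqP; split => y /=; rewrite in_itv/= andbT.
exact: normr_measurable.
Qed.

Lemma measurable_segment (m e : R) : measurable [set y : R | `|y - m| <= e].
Proof.
rewrite (_ : [set y | _] = `[m - e, m + e]%classic); first exact: measurable_itv.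
by apply/seteqP; split => y /=; rewrite in_itv/= ler_distl.
Qed.

Lemma normal_pdf0E (s y : R) : 0 < s -> normal_pdf 0 s y =
  (Num.sqrt (s ^+ 2 * pi *+ 2))^-1 * expR (- y ^+ 2 / (s ^+ 2 *+ 2)).
Proof. by move=> s0; rewrite normal_pdfE ?gt_eqF// /normal_fun subr0. Qed.

(* On [|y| > x] the density of N(0, s^2) is at most [2 exp (- x^2 / 4 s^2)] times
   the density of N(0, 2 s^2), whose total mass is 1. *)
Lemma normal_prob_tail (s x : R) : 0 < s -> 0 <= x ->
  (normal_prob 0 s [set y | (x < `|y|)%R] <= (2 * expR (- (x ^+ 2 / (4 * s ^+ 2))))%:E)%E.
Proof.
move=> s0 x0; set A := [set y | _].
have mA : measurable A := measurable_normr_gt x.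
set c := 2 * _.
have c0 : 0 <= c by rewrite mulr_ge0// expR_ge0.
pose s2 := Num.sqrt 2 * s.
have s20 : 0 < s2 by rewrite mulr_gt0// sqrtr_gt0.
have s2E : s2 ^+ 2 = 2 * s ^+ 2 by rewrite exprMn sqr_sqrtr.
apply: (@le_trans _ _ (c%:E * normal_prob 0 s2 A)%E); last first.
  rewrite -[leRHS]mule1; apply: lee_wpmul2l; first by rewrite lee_fin.
  exact: probability_le1.
rewrite /normal_prob -ge0_integralZl_EFin//; last 2 first.
- by move=> y _; rewrite lee_fin normal_pdf_ge0.
- by apply/measurable_EFinP/measurable_funTS; exact: measurable_normal_pdf.
apply: ge0_le_integral => //.
- by move=> y _; rewrite lee_fin normal_pdf_ge0.
- by apply/measurable_EFinP/measurable_funTS; exact: measurable_normal_pdf.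
- apply: measurable_funeM.
  by apply/measurable_EFinP/measurable_funTS; exact: measurable_normal_pdf.
move=> y; rewrite /A/= => xy; rewrite -EFinM lee_fin !normal_pdf0E// s2E.
have -> : 2 * s ^+ 2 * pi *+ 2 = 2 * (s ^+ 2 * pi *+ 2) by rewrite mulrnAr mulrA.
rewrite sqrtrM// invfM.
have -> : expR (- y ^+ 2 / (s ^+ 2 *+ 2)) =
    expR (- (y ^+ 2 / (4 * s ^+ 2))) * expR (- y ^+ 2 / (2 * s ^+ 2 *+ 2)).
  rewrite -expRD; congr expR; field; lra.
rewrite /c; set p := (Num.sqrt (s ^+ 2 * pi *+ 2))^-1.
set E := expR (- y ^+ 2 / _).
have p0 : 0 <= p by rewrite invr_ge0.
have E0 : 0 <= E by exact: expR_ge0.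
have -> : 2 * expR (- (x ^+ 2 / (4 * s ^+ 2))) * ((Num.sqrt 2)^-1 * p * E) =
   (2 / Num.sqrt 2) * (p * (expR (- (x ^+ 2 / (4 * s ^+ 2))) * E)) by ring.
(* This is where the factor 2 of the bound absorbs the ratio of the normalizing constants. *)
have h2 : 1 <= 2 / Num.sqrt 2 :> R.
  rewrite ler_pdivlMr ?sqrtr_gt0// mul1r.
  rewrite -[leRHS]ger0_norm// -sqrtr_sqr ler_wsqrtr//.
  by rewrite expr2; lra.
apply: (@le_trans _ _ (p * (expR (- (x ^+ 2 / (4 * s ^+ 2))) * E))).
  rewrite ler_wpM2l// ler_wpM2r// ler_expR lerN2 ler_pM2r ?invr_gt0; last nra.
  by rewrite -[leRHS]real_normK ?num_real// lerXn2r ?nnegrE// ltW.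
by rewrite ler_peMl// mulr_ge0// mulr_ge0// expR_ge0.
Qed.

(** Every point [y] of the segment satisfies [|y| <= a + e], so the exponent of the density is at
    least [- C / 2] there; this is multiplied by the length [2 e]. *)
Lemma normal_prob_segment (s m e a C : R) : 0 < s -> 0 <= e ->
  `|m| <= a -> (a + e) ^+ 2 <= C * s ^+ 2 ->
  ((2 * e * ((Num.sqrt (s ^+ 2 * pi *+ 2))^-1 * expR (- (C / 2))))%:E <=
   normal_prob 0 s [set y | (`|y - m| <= e)%R])%E.
Proof.
move=> s0 e0 ma aC.
rewrite (_ : [set y | _] = `[m - e, m + e]%classic); last first.
  by apply/seteqP; split => y /=; rewrite in_itv/= ler_distl.
set p := _^-1; have p0 : 0 <= p by rewrite invr_ge0.
set I := (`[_, _]%classic).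
apply: (@le_trans _ _ (\int[lebesgue_measure]_(y in I)
    cst (p * expR (- (C / 2)))%:E y)%E); rewrite {}/I.
  rewrite integral_cst//= lebesgue_measure_itv/= lte_fin.
  case: ltP => [_|h].
    by rewrite -EFinD -EFinM lee_fin; lra.
  (* The length formula has a separate branch for a degenerate interval. *)
  have -> : e = 0 by lra.
  by rewrite mulr0 mul0r mule0.
rewrite /normal_prob; apply: ge0_le_integral => //.
- by move=> y _; rewrite lee_fin mulr_ge0// expR_ge0.
- by apply/measurable_EFinP/measurable_funTS; exact: measurable_normal_pdf.
move=> y; rewrite /= in_itv/= => /andP[y1 y2].
rewrite lee_fin normal_pdf0E// -/p ler_wpM2l// ler_expR.
have s2 : 0 < s ^+ 2 by rewrite exprn_gt0.
rewrite mulNr lerN2 ler_pdivrMr; last by rewrite pmulrn_lgt0.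
have -> : C / 2 * (s ^+ 2 *+ 2) = C * s ^+ 2 by rewrite -mulr_natr; field.
apply: le_trans aC; have a0 : 0 <= a + e by have := normr_ge0 m; lra.
by move: ma; rewrite ler_norml => /andP[? ?]; nra.
Qed.

Definition outside (x : R) : set plane := [set v | x < `|v.1| \/ x < `|v.2|].
Definition square (m : plane) (e : R) : set plane :=
  [set v | `|v.1 - m.1| <= e /\ `|v.2 - m.2| <= e].

Lemma outsideE x : outside x =
  ([set y | x < `|y|] `*` setT) `|` (setT `*` [set y | x < `|y|]).
Proof. by apply/seteqP; split=> -[u v] /= [|]; [left|right|case; left|case; right]. Qed.

Lemma measurable_outside x : measurable (outside x).
Proof.
by rewrite outsideE; apply: measurableU; apply: measurableX => //;
  exact: measurable_normr_gt.
Qed.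

Lemma measurable_square m e : measurable (square m e).
Proof.
by rewrite (_ : square m e = [set y | `|y - m.1| <= e] `*` [set y | `|y - m.2| <= e])//;
  apply: measurableX; exact: measurable_segment.
Qed.

(** The Gaussian tail is weakened by [exp u >= u^3 / 3!] at [u = x^2 / 4 h]; two coordinates with
    factor 2 each give [4 * 6 * 4^3 = 1536]. *)
Lemma planar_gaussian_outside (h x : R) : 0 < h -> 0 < x ->
  (planar_gaussian h (outside x) <= (1536 * (h ^+ 3 / x ^+ 6))%:E)%E.
Proof.
move=> h0 x0; have s0 : 0 < Num.sqrt h by rewrite sqrtr_gt0.
have mA := measurable_normr_gt x.
rewrite outsideE /planar_gaussian; apply: le_trans (measureU2 _ _ _) _.
- exact: measurableX.
- exact: measurableX.
set q := expR (- (x ^+ 2 / (4 * h))).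
set N := normal_prob 0 (Num.sqrt h).
have tail : (N [set y | (x < `|y|)%R] <= (2 * q)%:E)%E.
  by have := normal_prob_tail s0 (ltW x0); rewrite sqr_sqrtr// ltW.
have tail1 : ((N \x N) ([set y | (x < `|y|)%R] `*` setT) <= (2 * q)%:E)%E.
  by rewrite product_measure1E// [X in (_ * X)%E]probability_setT mule1.
have tail2 : ((N \x N) (setT `*` [set y | (x < `|y|)%R]) <= (2 * q)%:E)%E.
  by rewrite product_measure1E// [X in (X * _)%E]probability_setT mul1e.
apply: le_trans (leeD tail1 tail2) _; rewrite -EFinD lee_fin.
have qle : q <= 6 / (x ^+ 2 / (4 * h)) ^+ 3.
  rewrite /q expRN; set u := x ^+ 2 / _.
  have u0 : 0 < u by rewrite divr_gt0 ?exprn_gt0// mulr_gt0.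
  have u3 : 0 < u ^+ 3 by rewrite exprn_gt0.
  have := expR_ge1Dxn 2 (ltW u0); rewrite (_ : 3`!%:R = 6 :> R)// => hu.
  rewrite -[leRHS]invrK lef_pV2 ?posrE ?expR_gt0//; last first.
    by rewrite invr_gt0 divr_gt0.
  by rewrite invf_div; lra.
apply: (le_trans (lerD (ler_wpM2l _ qle) (ler_wpM2l _ qle))) => //.
rewrite le_eqVlt; apply/orP; left; apply/eqP; field; lra.
Qed.

(** The product of the two one-dimensional bounds has the factor [2 e^2 / (pi h)], which is at least
    [e^2 / 2 h] since [pi <= 4]. *)
Lemma planar_gaussian_square (h e a C : R) (m : plane) : 0 < h -> 0 <= e ->
  `|m.1| <= a -> `|m.2| <= a -> (a + e) ^+ 2 <= C * h ->
  ((e ^+ 2 / (2 * h) * expR (- C))%:E <= planar_gaussian h (square m e))%E.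
Proof.
move=> h0 e0 m1 m2 aC; have s0 : 0 < Num.sqrt h by rewrite sqrtr_gt0.
have s2 : Num.sqrt h ^+ 2 = h by rewrite sqr_sqrtr// ltW.
rewrite (_ : square m e =
  [set y | `|y - m.1| <= e] `*` [set y | `|y - m.2| <= e])//.
rewrite /planar_gaussian product_measure1E//; try exact: measurable_segment.
have aC' : (a + e) ^+ 2 <= C * Num.sqrt h ^+ 2 by rewrite s2.
have q1 := normal_prob_segment s0 e0 m1 aC'.
have q2 := normal_prob_segment s0 e0 m2 aC'.
rewrite s2 in q1 q2; set q := 2 * e * _ in q1 q2.
have q0 : 0 <= q by rewrite !mulr_ge0// ?invr_ge0// expR_ge0.
apply: le_trans (lee_pmul _ _ q1 q2); rewrite ?lee_fin//.
have pi4 : pi <= 4 :> R by have [] := pihalf_02_cos_pihalf R; lra.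
have pi0 := pi_gt0 R.
have qE : q * q = 4 * e ^+ 2 * (h * pi *+ 2)^-1 * expR (- C).
  rewrite (_ : - C = - (C / 2) + - (C / 2)); last by field.
  have -> : (h * pi *+ 2)^-1 =
      (Num.sqrt (h * pi *+ 2))^-1 * (Num.sqrt (h * pi *+ 2))^-1.
    by rewrite -invfM -expr2 sqr_sqrtr// mulrn_wge0// mulr_ge0// ltW.
  by rewrite expRD /q; ring.
rewrite qE ler_wpM2r ?expR_ge0//.
have hp : 0 < h * pi by rewrite mulr_gt0.
have -> : 4 * e ^+ 2 * (h * pi *+ 2)^-1 = e ^+ 2 * (2 / (h * pi)).
  by rewrite -mulr_natr; move: (h * pi) hp => w w0; field; rewrite gt_eqF.
rewrite ler_wpM2l ?sqr_ge0// ler_pdivlMr// ler_pdivrMl ?mulr_gt0//.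
nra.
Qed.

End gaussian.

(** * Independence of increments *)

Section increments.
Context {R : realType} {d : measure_display} {Omega : measurableType d}.
Variables (P : probability Omega R) (B : R -> Omega -> R * R) (z : R * R).
Hypothesis B_bm : planar_brownian_motion P B z.

Definition pr (E : set Omega) : R := fine (P E).

Lemma prE E : measurable E -> P E = (pr E)%:E.
Proof. by move=> mE; rewrite /pr fineK// fin_num_measure. Qed.

Lemma pr_ge0 E : 0 <= pr E.
Proof. by rewrite /pr fine_ge0. Qed.

Lemma pr_setT : pr setT = 1.
Proof. by rewrite /pr probability_setT. Qed.

Lemma le_pr E F : measurable E -> measurable F -> E `<=` F -> pr E <= pr F.
Proof.
by move=> mE mF EF; rewrite -lee_fin -!prE//; apply: le_measure; rewrite ?inE.
Qed.

Lemma pr_setU E F : measurable E -> measurable F -> pr (E `|` F) <= pr E + pr F.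
Proof.
move=> mE mF; rewrite -lee_fin EFinD -!prE//; last exact: measurableU.
exact: measureU2.
Qed.

Lemma pr_setD E F : measurable E -> measurable F -> F `<=` E ->
  pr (E `\` F) = pr E - pr F.
Proof.
move=> mE mF FE; apply: EFin_inj; rewrite EFinB -!prE//; last exact: measurableD.
rewrite measureD//; last by rewrite -ge0_fin_numE// fin_num_measure.
by congr (_ - P _)%E; rewrite setIC; exact/setIidPl.
Qed.

Definition increment (u v : R) (A : set (R * R)) : set Omega :=
  [set w | A (B v w - B u w)].

Lemma measurable_increment u v A : 0 <= u -> 0 <= v -> measurable A ->
  measurable (increment u v A).
Proof.
move=> u0 v0 mA.
have /measurable_fun_pairP[mu1 mu2] := bm_measurable B_bm u0.
have /measurable_fun_pairP[mv1 mv2] := bm_measurable B_bm v0.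
have mf : measurable_fun setT (fun w => B v w - B u w).
  by apply/measurable_fun_pairP; split;
    [exact: measurable_funB mv1 mu1|exact: measurable_funB mv2 mu2].
by rewrite -[increment _ _ _]setTI; apply: mf.
Qed.

Lemma pr_increment u v A : 0 <= u -> u < v -> measurable A ->
  P (increment u v A) = planar_gaussian (v - u) A.
Proof. by move=> u0 uv mA; rewrite -(bm_gaussian B_bm u0 uv mA). Qed.

Definition rectangle n (t : nat -> R) (A : nat -> set (R * R)) : set Omega :=
  \bigcap_(i in `I_n) increment (t i) (t i.+1) (A i).

Lemma measurable_rectangle n t A : 0 <= t 0%N ->
  (forall i, (i < n)%N -> t i <= t i.+1) -> (forall i, measurable (A i)) ->
  measurable (rectangle n t A).
Proof.
move=> t0 tS mA.
have t_ge0 i : (i <= n)%N -> 0 <= t i.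
  by elim: i => // i IH iN; rewrite (le_trans (IH (ltnW iN)))// tS.
rewrite /rectangle; have [->|n0] := eqVneq n 0%N.
  by rewrite (_ : `I_0 = set0) ?bigcap_set0//; apply/seteqP; split.
apply: bigcap_measurable; first by exists 0%N; rewrite /= lt0n.
by move=> i /= iN; apply: measurable_increment => //; apply: t_ge0 => //; exact: ltnW.
Qed.

(* Independence is only tested on rectangles of finitely many increments after s:
   this is preserved by adding increments and by proper differences, which is all
   that the first successful trial needs, and avoids monotone class arguments. *)
Definition past (s : R) (E : set Omega) : Prop := measurable E /\
  forall n t A, s <= t 0%N -> (forall i, (i < n)%N -> t i <= t i.+1) ->
    (forall i, measurable (A i)) ->
    pr (E `&` rectangle n t A) = pr E * pr (rectangle n t A).

Lemma past_setT s : past s setT.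
Proof. by split=> // n t A _ _ _; rewrite setTI pr_setT mul1r. Qed.

Lemma past_le s s' E : s <= s' -> past s E -> past s' E.
Proof. by move=> ss' [mE EP]; split => // n t A s't; apply/EP/(le_trans ss'). Qed.

Lemma past_setD s E F : 0 <= s -> past s E -> past s F -> F `<=` E ->
  past s (E `\` F).
Proof.
move=> s0 [mE EP] [mF FP] FE; split; first exact: measurableD.
move=> n t A st tS mA.
have mT : measurable (rectangle n t A).
  by apply: measurable_rectangle => //; exact: le_trans st.
have -> : (E `\` F) `&` rectangle n t A =
    (E `&` rectangle n t A) `\` (F `&` rectangle n t A).
  apply/seteqP; split => w /=; first by move=> [[? nF] ?]; split => // -[].
  by move=> [[Ew Tw] nF]; split => //; split => // Fw; apply: nF.
rewrite pr_setD ?EP ?FP ?pr_setD ?mulrBl//; try exact: measurableI.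
exact: setSI.
Qed.

Lemma pr_rectangle n t A : 0 <= t 0%N ->
  (forall i, (i < n)%N -> t i <= t i.+1) -> (forall i, measurable (A i)) ->
  pr (rectangle n t A) = \prod_(i < n) pr (increment (t i) (t i.+1) (A i)).
Proof.
move=> t0 tS mA.
have t_ge0 i : (i <= n)%N -> 0 <= t i.
  by elim: i => // i IH iN; rewrite (le_trans (IH (ltnW iN)))// tS.
apply: EFin_inj; rewrite -prE; last exact: measurable_rectangle.
rewrite /rectangle (bm_independent B_bm)// -prodEFin; apply: eq_bigr => i _.
rewrite -prE//; apply: measurable_increment => //; apply: t_ge0 => //.
exact: ltnW.
Qed.

Lemma past_increment s s' u v E A : 0 <= s -> past s E ->
  s <= u -> u <= v -> v <= s' -> measurable A ->
  past s' (E `&` increment u v A) /\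
  pr (E `&` increment u v A) = pr E * pr (increment u v A).
Proof.
move=> s0 [mE EP] su uv vs' mA.
have u0 : 0 <= u := le_trans s0 su; have v0 : 0 <= v := le_trans u0 uv.
have mX : measurable (increment u v A) by exact: measurable_increment.
have key n t C : s' <= t 0%N -> (forall i, (i < n)%N -> t i <= t i.+1) ->
    (forall i, measurable (C i)) ->
    pr (E `&` increment u v A `&` rectangle n t C) =
    pr E * (pr (increment u v A) * pr (rectangle n t C)).
  move=> s't tS mC.
  have t0 : 0 <= t 0%N by rewrite (le_trans v0)// (le_trans vs').
  (* Two increments are put in front of the rectangle: the given one over [[u, v]], then an
     unconstrained one bridging the gap from [v] to [t 0]. *)
  pose t' i := match i with 0%N => u | 1%N => v | i.+2 => t i end.
  pose C' i := match i with 0%N => A | 1%N => setT | i.+2 => C i end.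
  have t'S i : (i < n.+2)%N -> t' i <= t' i.+1.
    by case: i => [//|[|i]] iN; [exact: le_trans vs' s't|apply: tS].
  have mC' i : measurable (C' i) by case: i => [|[|i]] /=.
  have -> : E `&` increment u v A `&` rectangle n t C = E `&` rectangle n.+2 t' C'.
    apply/seteqP; split => w.
      by move=> [[Ew Xw] Tw]; split => // -[|[|i]]//= iN; exact: Tw.
    move=> [Ew Tw]; split; first by split => //; exact: (Tw 0%N).
    by move=> i iN; exact: (Tw i.+2).
  rewrite EP// [in LHS]pr_rectangle// !big_ord_recl/= pr_rectangle//; congr (_ * (_ * _)).
  have -> : increment v (t 0%N) setT = setT by [].
  by rewrite pr_setT mul1r; apply: eq_bigr.
have rect0 : rectangle 0 (fun=> s') (fun=> setT) = setT.
  by rewrite /rectangle (_ : `I_0 = set0) ?bigcap_set0//; apply/seteqP; split.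
have EX : pr (E `&` increment u v A) = pr E * pr (increment u v A).
  have := key 0%N (fun=> s') (fun=> setT) (lexx _).
  by rewrite rect0 setIT pr_setT mulr1; apply.
split=> //; split; first exact: measurableI.
by move=> n t C s't tS mC; rewrite key// EX mulrA.
Qed.

(** The i-th interval may be any subinterval of the i-th step: this allows one full step to be
    replaced by a dyadic piece of it. *)
Lemma past_steps s h n (u v : nat -> R) Q E : 0 <= s -> 0 <= h -> past s E ->
  (forall i, (i < n)%N ->
    [/\ s + h * i%:R <= u i, u i <= v i & v i <= s + h * i.+1%:R]) ->
  (forall i, measurable (Q i)) ->
  past (s + h * n%:R) (E `&` \bigcap_(i in `I_n) increment (u i) (v i) (Q i)) /\
  pr (E `&` \bigcap_(i in `I_n) increment (u i) (v i) (Q i)) =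
    pr E * \prod_(i < n) pr (increment (u i) (v i) (Q i)).
Proof.
move=> s0 h0 Es uv mQ; elim: n uv => [|n IH] uv.
  rewrite mulr0 addr0 big_ord0 mulr1 (_ : `I_0 = set0) ?bigcap_set0 ?setIT//.
  by apply/seteqP; split.
have [|IHp IHe] := IH; first by move=> i iN; apply: uv; exact: ltnW.
have [un uvn vn] := uv n (ltnSn n).
have -> : E `&` \bigcap_(i in `I_n.+1) increment (u i) (v i) (Q i) =
   E `&` \bigcap_(i in `I_n) increment (u i) (v i) (Q i) `&` increment (u n) (v n) (Q n).
  apply/seteqP; split => w.
    move=> [Ew Tw]; split; last exact: (Tw n (ltnSn n)).
    by split => // i iN; apply: Tw; exact: ltnW.
  move=> [[Ew Tw] Xw]; split => // i /=; rewrite ltnS leq_eqVlt => /orP[/eqP->//|].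
  exact: Tw.
have [|Xp Xe] := past_increment _ IHp un uvn vn (mQ n).
  by rewrite addr_ge0// mulr_ge0.
by split => //; rewrite Xe IHe big_ord_recr/= mulrA.
Qed.

End increments.

(** * Oscillation of the path *)

Section dyadic.
Context {R : realType}.

Definition dyadic (a h : R) (l j : nat) : R := a + h * (j%:R / (2 ^ l)%:R).

Lemma dyadic_double a h l j : dyadic a h l.+1 j.*2 = dyadic a h l j.
Proof.
rewrite /dyadic expnS !natrM -mul2n natrM; congr (_ + _ * _).
by field; rewrite pnatr_eq0 expn_eq0.
Qed.

Lemma dyadic_in a h l j : 0 <= h -> (j <= 2 ^ l)%N -> a <= dyadic a h l j <= a + h.
Proof.
move=> h0 jl; rewrite /dyadic lerDl lerD2l; apply/andP; split.
  by rewrite mulr_ge0// divr_ge0.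
by rewrite ler_piMr// ler_pdivrMr ?ltr0n ?expn_gt0// mul1r ler_nat.
Qed.

(** An odd point of level [l + 1] is one step away from its even predecessor, a point of level [l].
    The bound is the partial sum of the geometric series of ratio 9/10, hence the total
    [10 * lam]. *)
Lemma dyadic_chaining (q : R -> R) a h lam : 0 <= lam ->
  (forall l j, (j < 2 ^ l)%N ->
    `|q (dyadic a h l j.+1) - q (dyadic a h l j)| <= lam * (9 / 10) ^+ l) ->
  forall l j, (j <= 2 ^ l)%N ->
    `|q (dyadic a h l j) - q a| <= 10 * lam * (1 - (9 / 10) ^+ l.+1).
Proof.
move=> lam0 qS; elim=> [|l IH] j jl.
  have dy0 : dyadic a h 0 0 = a by rewrite /dyadic mul0r mulr0 addr0.
  case: j jl => [|[|//]] _; first by rewrite dy0 subrr normr0 expr1; lra.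
  by have := qS 0%N 0%N isT; rewrite dy0 expr0 expr1; lra.
have even i : (i <= 2 ^ l)%N ->
    `|q (dyadic a h l.+1 i.*2) - q a| <= 10 * lam * (1 - (9 / 10) ^+ l.+1).
  by move=> il; rewrite dyadic_double; exact: IH.
have pow : 0 <= lam * (9 / 10 : R) ^+ l.+1 by rewrite mulr_ge0// exprn_ge0//; lra.
have powS : lam * (9 / 10 : R) ^+ l.+2 = 9 / 10 * (lam * (9 / 10) ^+ l.+1).
  by rewrite [in LHS]exprS; ring.
have hl : (j./2 <= 2 ^ l)%N by have := half_leq jl; rewrite expnS mul2n doubleK.
rewrite -(odd_double_half j); case: (boolP (odd j)) => oj.
  have jl' : (j./2.*2 < 2 ^ l.+1)%N.
    by move: jl; rewrite -{1}(odd_double_half j) oj.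
  have := even _ hl; have := qS _ _ jl'; rewrite add1n.
  have := ler_distD (q (dyadic a h l.+1 j./2.*2)) (q (dyadic a h l.+1 j./2.*2.+1)) (q a).
  by lra.
by rewrite add0n; have := even _ hl; lra.
Qed.

Lemma dyadic_dense a h t (e : R) : 0 < h -> 0 < e -> a <= t <= a + h ->
  exists l j, (j <= 2 ^ l)%N /\ `|dyadic a h l j - t| < e.
Proof.
move=> h0 e0 /andP[at' th].
pose l := (Num.truncn (h / e)).+1.
have he : h / e < (2 ^ l)%:R.
  apply: (lt_trans (truncnS_gt _)).
  by rewrite ltr_nat; exact: ltn_expl.
have P0 : 0 < (2 ^ l)%:R :> R by rewrite ltr0n expn_gt0.
pose x := (t - a) / h * (2 ^ l)%:R.
have x0 : 0 <= x by rewrite mulr_ge0// divr_ge0 ?subr_ge0// ltW.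
have xl : x <= (2 ^ l)%:R.
  by rewrite /x ler_piMl ?(ltW P0)// ler_pdivrMr// mul1r; lra.
have [jx xj] : (Num.truncn x)%:R <= x /\ x < (Num.truncn x).+1%:R.
  by have /andP[] := truncn_itv x0.
exists l, (Num.truncn x); split; first by rewrite -(ler_nat R) (le_trans jx).
rewrite /dyadic; set j := Num.truncn x in jx xj *.
have tx : t = a + h * (x / (2 ^ l)%:R).
  by rewrite /x; field; rewrite !gt_eqF.
rewrite tx opprD addrACA subrr add0r -mulrBr -mulrBl normrM (gtr0_norm h0).
rewrite normrM normfV (gtr0_norm P0) mulrA ltr_pdivrMr//.
have : h < e * (2 ^ l)%:R by rewrite mulrC -ltr_pdivrMr.
apply: le_lt_trans; rewrite ler_piMr ?(ltW h0)//.
by rewrite ler_norml; move: xj; rewrite -natr1; lra.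
Qed.

Lemma dyadic_oscillation (q : R -> R) a h lam : 0 <= a -> 0 < h -> 0 <= lam ->
  {within `[0, +oo[, continuous q} ->
  (forall l j, (j < 2 ^ l)%N ->
    `|q (dyadic a h l j.+1) - q (dyadic a h l j)| <= lam * (9 / 10) ^+ l) ->
  forall t, a <= t <= a + h -> `|q t - q a| <= 10 * lam.
Proof.
move=> a0 h0 lam0 cq qS t tah; apply/ler_addgt0Pr => e e0.
have t0 : 0 <= t by lra.
have : q x @[x --> within `[0, +oo[%classic (nbhs t)] --> q t.
  move/subspace_continuousP : cq => /(_ t); apply.
  by rewrite /= in_itv/= andbT.
move=> /cvgrPdist_lt/(_ e e0); rewrite /prop_near1 /within/=.
move=> /nbhs_ballP[r/= r0 rq].
have [l [j [jl jt]]] := dyadic_dense h0 r0 tah.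
have /andP[ad _] := dyadic_in a (ltW h0) jl.
have := rq (dyadic a h l j); rewrite /ball/= distrC => /(_ jt).
rewrite in_itv/= andbT (le_trans a0 ad) => /(_ isT) qd.
have := dyadic_chaining lam0 qS jl.
have := ler_distD (q (dyadic a h l j)) (q t) (q a).
have : 0 <= lam * (9 / 10 : R) ^+ l.+1 by rewrite mulr_ge0// exprn_ge0//; lra.
by lra.
Qed.

End dyadic.

(** * Probability of a large oscillation *)

Section oscillation.
Context {R : realType} {d : measure_display} {Omega : measurableType d}.
Variables (P : probability Omega R) (B : R -> Omega -> R * R) (z : R * R).
Hypothesis B_bm : planar_brownian_motion P B z.
Local Notation pr := (pr P).
Local Notation increment := (increment B).

(** The thresholds must decrease for chaining, but slowly: with ratio 9/10 the probabilities of the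
    levels still decay at least like [2^-l]. *)
Definition rough_level (a h lam : R) (l : nat) : set Omega :=
  \big[setU/set0]_(j < 2 ^ l)
    increment (dyadic a h l j) (dyadic a h l j.+1) (outside (lam * (9 / 10) ^+ l)).

Definition rough (a h lam : R) : set Omega := \bigcup_l rough_level a h lam l.

Lemma dyadic_increment_measurable a h l (j : 'I_(2 ^ l)) x : 0 <= a -> 0 < h ->
  measurable (increment (dyadic a h l j) (dyadic a h l j.+1) (outside x)).
Proof.
move=> a0 h0; apply: (measurable_increment B_bm); last exact: measurable_outside.
  by have /andP[] := dyadic_in a (ltW h0) (ltnW (ltn_ord j)); lra.
by have /andP[] := dyadic_in a (ltW h0) (ltn_ord j); lra.
Qed.

Lemma measurable_rough_level a h lam l : 0 <= a -> 0 < h ->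
  measurable (rough_level a h lam l).
Proof.
move=> a0 h0; apply: bigsetU_measurable => j _.
exact: dyadic_increment_measurable.
Qed.

Lemma measurable_rough a h lam : 0 <= a -> 0 < h -> measurable (rough a h lam).
Proof. by move=> a0 h0; apply: bigcupT_measurable => l; exact: measurable_rough_level. Qed.

Lemma not_rough_oscillation a h lam w : 0 <= a -> 0 < h -> 0 <= lam ->
  {within `[0, +oo[, continuous (fun t => B t w)} -> ~ rough a h lam w ->
  forall t, a <= t <= a + h ->
    `|(B t w).1 - (B a w).1| <= 10 * lam /\ `|(B t w).2 - (B a w).2| <= 10 * lam.
Proof.
move=> a0 h0 lam0 cB nr t tah.
have steps l j : (j < 2 ^ l)%N ->
    `|(B (dyadic a h l j.+1) w).1 - (B (dyadic a h l j) w).1| <= lam * (9 / 10) ^+ l /\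
    `|(B (dyadic a h l j.+1) w).2 - (B (dyadic a h l j) w).2| <= lam * (9 / 10) ^+ l.
  move=> jl; suff : ~ outside (lam * (9 / 10) ^+ l)
      (B (dyadic a h l j.+1) w - B (dyadic a h l j) w).
    by rewrite /outside/= => /not_orP[/negP + /negP]; rewrite -!leNgt.
  move=> out; apply: nr; exists l => //; rewrite /rough_level.
  rewrite -(bigcup_mkord _ (fun j => increment (dyadic a h l j) (dyadic a h l j.+1)
    (outside (lam * (9 / 10) ^+ l)))).
  by exists j.
have cc (f : R * R -> R) : continuous f ->
    {within `[0, +oo[, continuous (fun t => f (B t w))}.
  move=> cf; apply/subspace_continuousP => u u0.
  apply: (@cvg_comp _ _ _ (fun t => B t w) f); last exact: cf.
  by move/subspace_continuousP : cB => /(_ _ u0).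
split.
  apply: (@dyadic_oscillation _ (fun t => (B t w).1) a h) => //.
  - by apply: cc => x; exact: cvg_fst.
  - by move=> l j /steps[].
apply: (@dyadic_oscillation _ (fun t => (B t w).2) a h) => //.
- by apply: cc => x; exact: cvg_snd.
- by move=> l j /steps[].
Qed.

Lemma pr_bigcup_geometric (F : nat -> set Omega) (c : R) : 0 <= c ->
  (forall l, measurable (F l)) -> (forall l, pr (F l) <= c / (2 ^ l.+1)%:R) ->
  pr (\bigcup_l F l) <= c.
Proof.
move=> c0 mF Fc; have mU := bigcupT_measurable _ mF.
rewrite -lee_fin -prE//.
have /(_ mF mU (@subset_refl _ _)) := @measure_sigma_subadditive _ _ _ P (\bigcup_l F l) F.
move=> /le_trans; apply.
(* The zero series is added to match the form of [epsilon_trick], which sums the terms [c / 2^(l+1)]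
   to [c]. *)
apply: (@le_trans _ _ (\sum_(0 <= l <oo) (0 + (c / (2 ^ l.+1)%:R)%:E))%E).
  apply: lee_nneseries => // l _.
  have h : (P (F l) <= (c / (2 ^ l.+1)%:R)%:E)%E by rewrite prE// lee_fin.
  by rewrite add0e; exact: h.
by apply: le_trans (epsilon_trick _ _ _) _ => //; rewrite eseries0 ?add0e.
Qed.

(* With [c = pr E] the hypothesis says that E is independent of the increments
   over subintervals of [a, a + h]. *)
Lemma pr_rough E a h lam c : measurable E -> 0 <= a -> 0 < h -> 0 < lam -> 0 <= c ->
  (forall u v x, a <= u -> u < v -> v <= a + h ->
     pr (E `&` increment u v (outside x)) <= c * pr (increment u v (outside x))) ->
  pr (E `&` rough a h lam) <= c * (3072 * (h ^+ 3 / lam ^+ 6)).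
Proof.
move=> mE a0 h0 lam0 c0 Ec.
have H0 : 0 <= h ^+ 3 / lam ^+ 6 by rewrite divr_ge0 ?exprn_ge0 ?ltW.
rewrite /rough setI_bigcupr; apply: pr_bigcup_geometric.
- exact: mulr_ge0 c0 (mulr_ge0 (ler0n _ 3072) H0).
- by move=> l; apply: measurableI => //; exact: measurable_rough_level.
move=> l; set x := lam * (9 / 10) ^+ l.
have x0 : 0 < x by rewrite mulr_gt0// exprn_gt0//; lra.
have N0 : 0 < (2 ^ l)%:R :> R by rewrite ltr0n expn_gt0.
have one (j : 'I_(2 ^ l)) :
    pr (E `&` increment (dyadic a h l j) (dyadic a h l j.+1) (outside x)) <=
    c * (1536 * ((h / (2 ^ l)%:R) ^+ 3 / x ^+ 6)).
  have step : dyadic a h l j.+1 - dyadic a h l j = h / (2 ^ l)%:R.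
    by rewrite /dyadic -natr1; field; rewrite gt_eqF.
  have hN : 0 < h / (2 ^ l)%:R by rewrite divr_gt0.
  have lt : dyadic a h l j < dyadic a h l j.+1 by rewrite -subr_gt0 step.
  have /andP[ja _] := dyadic_in a (ltW h0) (ltnW (ltn_ord j)).
  have /andP[_ jah] := dyadic_in a (ltW h0) (ltn_ord j).
  apply: le_trans (Ec _ _ _ ja lt jah) _; rewrite ler_wpM2l//.
  rewrite -lee_fin -prE; last exact: dyadic_increment_measurable.
  rewrite (pr_increment B_bm) ?(le_trans a0)//; last exact: measurable_outside.
  by rewrite step; exact: planar_gaussian_outside.
have -> : E `&` rough_level a h lam l = \big[setU/set0]_(j < 2 ^ l)
    (E `&` increment (dyadic a h l j) (dyadic a h l j.+1) (outside x)).
  by rewrite /rough_level big_distrr.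
pose F j := E `&` increment (dyadic a h l j) (dyadic a h l j.+1) (outside x).
have mF j : (j < 2 ^ l)%N -> measurable (F j).
  move=> jl; apply: measurableI => //.
  exact: (dyadic_increment_measurable (Ordinal jl)).
apply: (@le_trans _ _ (\sum_(j < 2 ^ l) pr (F j))).
  rewrite -lee_fin -prE; last by apply: bigsetU_measurable => j _; exact: mF.
  apply: le_trans (Boole_inequality _ mF) _; rewrite -sumEFin.
  apply: lee_sum => j _.
  have PF : (P (F j) <= (pr (F j))%:E)%E by rewrite prE//; exact: mF.
  exact: PF.
apply: le_trans (ler_sum _ (fun j _ => one j)) _.
rewrite sumr_const card_ord -[leLHS]mulr_natl expnS natrM.
set N := (2 ^ l)%:R in N0 *; set y := (9 / 10 : R) ^+ l.
have y0 : 0 < y by rewrite exprn_gt0//; lra.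
(* Level [l] has [N] pieces, each contributing a multiple of [N^-3 y^-6]; as [2 * (9 / 10)^6 >= 1],
   the total is at most a multiple of [1 / N]. *)
have Ny : 1 <= N * y ^+ 6.
  rewrite /N /y natrX -exprM mulnC exprM -exprMn exprn_ege1//.
  by rewrite !exprS expr0; lra.
have -> : N * (c * (1536 * ((h / N) ^+ 3 / x ^+ 6))) =
    (c * (1536 * (h ^+ 3 / lam ^+ 6)) / N) / (N * y ^+ 6).
  by rewrite /x -/y; field; rewrite !gt_eqF.
have -> : c * (3072 * (h ^+ 3 / lam ^+ 6)) / (2 * N) =
    c * (1536 * (h ^+ 3 / lam ^+ 6)) / N.
  by field; rewrite !gt_eqF.
have T0 : 0 <= c * (1536 * (h ^+ 3 / lam ^+ 6)) / N.
  exact: divr_ge0 (mulr_ge0 c0 (mulr_ge0 (ler0n _ 1536) H0)) (ltW N0).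
move: (_ / N) T0 => T T0.
by rewrite ler_pdivrMr ?(lt_le_trans ltr01)// ler_peMr.
Qed.

End oscillation.

(** * Trials *)

Section windows.
Context {R : realType} {d : measure_display} {Omega : measurableType d}.
Variables (P : probability Omega R) (B : R -> Omega -> R * R) (z : R * R).
Hypothesis B_bm : planar_brownian_motion P B z.
Local Notation pr := (pr P).
Local Notation increment := (increment B).
Local Notation past := (past P B).
Local Notation rough := (rough B).

Definition steps s h n (Q : nat -> set (R * R)) : set Omega :=
  \bigcap_(i in `I_n) increment (s + h * i%:R) (s + h * i.+1%:R) (Q i).

Definition some_rough s h n lam : set Omega :=
  \big[setU/set0]_(i < n) rough (s + h * i%:R) h lam.

Lemma step_le (s h : R) (i : nat) : 0 <= h -> s + h * i%:R <= s + h * i.+1%:R.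
Proof. by move=> h0; rewrite lerD2l ler_wpM2l// ler_nat. Qed.

Lemma past_steps_grid s h n Q E : 0 <= s -> 0 <= h -> past s E ->
  (forall i, measurable (Q i)) ->
  past (s + h * n%:R) (E `&` steps s h n Q) /\
  pr (E `&` steps s h n Q) =
    pr E * \prod_(i < n) pr (increment (s + h * i%:R) (s + h * i.+1%:R) (Q i)).
Proof.
move=> s0 h0 Es mQ; apply: (past_steps B_bm) => // i _.
by split=> //; exact: step_le.
Qed.

Lemma pr_le_prod_others n (p : nat -> R) c (i : 'I_n) : 0 < c ->
  (forall j, (j < n)%N -> c <= p j) ->
  \prod_(j < n | j != i) p j <= \prod_(j < n) p j / c.
Proof.
move=> c0 cp; rewrite ler_pdivlMr// [leRHS](bigD1 i)//= mulrC ler_wpM2r ?cp//.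
by apply: prodr_ge0 => j _; rewrite (le_trans (ltW c0))// cp.
Qed.

(** For each step, its own constraint is dropped, the oscillation bound is applied independently of
    the other constraints, and the missing factor is restored at the cost of [1 / c]. The sum over
    the steps gives [n]. *)
Lemma pr_steps_rough s h n Q E lam c : 0 <= s -> 0 < h -> 0 < lam -> 0 < c ->
  past s E -> (forall i, measurable (Q i)) ->
  (forall i, (i < n)%N ->
     c <= pr (increment (s + h * i%:R) (s + h * i.+1%:R) (Q i))) ->
  pr (E `&` steps s h n Q `&` some_rough s h n lam) <=
    pr (E `&` steps s h n Q) * (n%:R * (3072 * (h ^+ 3 / lam ^+ 6)) / c).
Proof.
move=> s0 h0 lam0 c0 Es mQ cQ.
have grid0 i : 0 <= s + h * i%:R by rewrite addr_ge0// mulr_ge0// ltW.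
have [[mEQ _] prEQ] := past_steps_grid n s0 (ltW h0) Es mQ.
set D := 3072 * _.
set p := fun i => pr (increment (s + h * i%:R) (s + h * i.+1%:R) (Q i)) in prEQ *.
have mrough i : measurable (rough (s + h * i%:R) h lam).
  by apply: (measurable_rough B_bm).
have one (i : 'I_n) :
    pr (E `&` steps s h n Q `&` rough (s + h * i%:R) h lam) <=
    pr (E `&` steps s h n Q) * (D / c).
  pose Q' l := if l == i :> nat then setT else Q l.
  have mQ' l : measurable (Q' l) by rewrite /Q'; case: ifP.
  have [[mE' _] _] := past_steps_grid n s0 (ltW h0) Es mQ'.
  pose q := pr E * \prod_(l < n | l != i) p l.
  have q0 : 0 <= q by rewrite mulr_ge0 ?pr_ge0// prodr_ge0// => l _; rewrite pr_ge0.
  apply: (@le_trans _ _ (pr (E `&` steps s h n Q' `&` rough (s + h * i%:R) h lam))).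
    apply: le_pr; [exact: measurableI|exact: measurableI|].
    apply: setSI; apply: setIS => w Qw l ln.
    by have := Qw l ln; rewrite /Q' /increment/=; case: ifP.
  apply: (@le_trans _ _ (q * D)).
    apply: (pr_rough B_bm) => // u v x au uv va.
    (* On step [i] the constraint becomes a large increment over the piece [[u, v]]; the other steps
       keep theirs, so [past_steps] factorizes the whole. *)
    pose Q'' l := if l == i :> nat then outside x else Q l.
    have mQ'' l : measurable (Q'' l).
      by rewrite /Q''; case: ifP => // _; exact: measurable_outside.
    pose u' l := if l == i :> nat then u else s + h * l%:R.
    pose v' l := if l == i :> nat then v else s + h * l.+1%:R.
    have -> : E `&` steps s h n Q' `&` increment u v (outside x) =
        E `&` \bigcap_(l in `I_n) increment (u' l) (v' l) (Q'' l).
      apply/seteqP; split=> w.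
        move=> [[Ew Qw] Xw]; split=> // l ln; have := Qw l ln.
        by rewrite /Q' /Q'' /u' /v'; case: ifP.
      move=> [Ew Qw]; split.
        split=> // l ln; have := Qw l ln.
        by rewrite /Q' /Q'' /u' /v'; case: ifP.
      by have := Qw i (ltn_ord i); rewrite /Q'' /u' /v' eqxx.
    have [|_ ->] := past_steps B_bm (n := n) (u := u') (v := v') s0 (ltW h0) Es _ mQ''.
      move=> l ln; rewrite /u' /v'; case: ifP => [/eqP->|_].
        by split => //; [exact: ltW|rewrite -natr1 mulrDr mulr1 addrA].
      by split=> //; apply: step_le; exact: ltW.
    rewrite (bigD1 i)//= {1}/u' {1}/v' {1}/Q'' eqxx mulrCA mulrC -mulrA.
    rewrite /q -mulrA le_eqVlt; apply/orP; left; apply/eqP; congr (_ * _).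
    rewrite [RHS]mulrC mulrC; congr (_ * _); apply: eq_bigr => l li.
    by rewrite /u' /v' /Q'' !(negbTE (li : l != i :> nat)).
  have D0 : 0 <= D.
    exact: mulr_ge0 (ler0n _ 3072) (divr_ge0 (exprn_ge0 _ (ltW h0)) (exprn_ge0 _ (ltW lam0))).
  have := pr_le_prod_others i c0 cQ; rewrite -/p => le_others.
  have := ler_wpM2r D0 (ler_wpM2l (pr_ge0 P E) le_others).
  by rewrite prEQ -/q [D / c]mulrC !mulrA.
have -> : E `&` steps s h n Q `&` some_rough s h n lam = \big[setU/set0]_(i < n)
    (E `&` steps s h n Q `&` rough (s + h * i%:R) h lam).
  by rewrite /some_rough big_distrr.
pose F i := E `&` steps s h n Q `&` rough (s + h * i%:R) h lam.
have mF i : (i < n)%N -> measurable (F i) by move=> _; exact: measurableI.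
apply: (@le_trans _ _ (\sum_(i < n) pr (F i))).
  rewrite -lee_fin -prE; last by apply: bigsetU_measurable => j _; exact: mF.
  apply: le_trans (Boole_inequality _ mF) _; rewrite -sumEFin.
  apply: lee_sum => j _.
  have PF : (P (F j) <= (pr (F j))%:E)%E by rewrite prE//; exact: mF.
  exact: PF.
apply: le_trans (ler_sum _ (fun j _ => one j)) _.
by rewrite sumr_const card_ord -[leLHS]mulr_natl mulrCA (mulrA n%:R).
Qed.

Definition target (r : R) (n i : nat) : R * R :=
  (r * ((curve (8 / n%:R * i.+1%:R)).1 - (curve (8 / n%:R * i%:R)).1),
   r * ((curve (8 / n%:R * i.+1%:R)).2 - (curve (8 / n%:R * i%:R)).2)).

(** Time is scaled by [r^2] and space by [r]. The tolerance [r / 8n] per step adds up to at most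
    [r / 8] over the window. *)
Definition steer (s r : R) (n : nat) : set Omega :=
  steps s (8 * r ^+ 2 / n%:R) n (fun i => square (target r n i) (r / (8 * n%:R))).

Lemma target_small r n i : 0 < r -> (0 < n)%N ->
  `|(target r n i).1| <= 208 * r / n%:R /\ `|(target r n i).2| <= 208 * r / n%:R.
Proof.
move=> r0 n0; have N0 : 0 < n%:R :> R by rewrite ltr0n.
have st : 8 / n%:R * i%:R <= 8 / n%:R * i.+1%:R :> R.
  by rewrite ler_wpM2l ?ler_nat// divr_ge0.
have := curve_lipschitz st.
have -> : 26 * (8 / n%:R * i.+1%:R - 8 / n%:R * i%:R) = 208 / n%:R :> R.
  by rewrite -natr1; field; rewrite gt_eqF.
have -> : 208 * r / n%:R = r * (208 / n%:R) by ring.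
by move=> [h1 h2]; rewrite /target/= !normrM (gtr0_norm r0) !ler_pM2l.
Qed.

(** With [y = r / n], the increments allowed are at most [208 y + y / 8] per coordinate, while
    [h = 8 n y^2]; the constant 74 satisfies [(1665 / 8)^2 <= 8 * 74^2]. The prefactor [e^2 / 2 h]
    equals [1 / 1024 n], so the bound does not depend on the scale. *)
Lemma pr_steer_step s r n i : 0 <= s -> 0 < r -> (0 < n)%N ->
  expR (- (74 ^+ 2)) / (1024 * n%:R) <=
  pr (increment (s + 8 * r ^+ 2 / n%:R * i%:R) (s + 8 * r ^+ 2 / n%:R * i.+1%:R)
        (square (target r n i) (r / (8 * n%:R)))).
Proof.
move=> s0 r0 n0; have N0 : 0 < n%:R :> R by rewrite ltr0n.
have N1 : 1 <= n%:R :> R by rewrite ler1n.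
set h := 8 * r ^+ 2 / n%:R; set e := r / _.
have h0 : 0 < h by rewrite divr_gt0// mulr_gt0// exprn_gt0.
have e0 : 0 <= e by rewrite divr_ge0 ?(ltW r0)// mulr_ge0// ltW.
have step : s + h * i.+1%:R - (s + h * i%:R) = h by rewrite -natr1; ring.
have [t1 t2] := @target_small r n i r0 n0.
have eh : e ^+ 2 / (2 * h) * expR (- (74 ^+ 2)) = expR (- (74 ^+ 2)) / (1024 * n%:R).
  by rewrite /e /h; move: (expR _) => E; field; rewrite !gt_eqF.
rewrite -eh -lee_fin -prE; last first.
  apply: (measurable_increment B_bm); last exact: measurable_square.
    by rewrite addr_ge0// mulr_ge0// ltW.
  by rewrite addr_ge0// mulr_ge0// ltW.
rewrite (pr_increment B_bm); last exact: measurable_square.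
- rewrite step; apply: (planar_gaussian_square h0 e0 t1 t2).
  have eE : e = 1 / 8 * (r / n%:R) by rewrite /e; field; rewrite gt_eqF.
  have hE : h = 8 * (r / n%:R) ^+ 2 * n%:R by rewrite /h; field; rewrite gt_eqF.
  rewrite eE hE -(mulrA 208); move: (r / _) => y.
  have -> : (208 * y + 1 / 8 * y) ^+ 2 = (1665 / 8) ^+ 2 * y ^+ 2 by field.
  have y2 := sqr_ge0 y; have : y ^+ 2 <= y ^+ 2 * n%:R by rewrite ler_peMr.
  by rewrite -[8 * y ^+ 2 * _]mulrA; move: (y ^+ 2 * _) => w; lra.
- by rewrite addr_ge0// mulr_ge0// ltW.
- by rewrite -subr_gt0 step.
Qed.

End windows.

(** * Successive trials and the first success *)

Section trials.
Context {R : realType} {d : measure_display} {Omega : measurableType d}.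
Variables (P : probability Omega R) (B : R -> Omega -> R * R) (z : R * R).
Hypothesis B_bm : planar_brownian_motion P B z.
Local Notation pr := (pr P).
Local Notation past := (past P B).
Local Notation rough := (rough B).
Local Notation steer := (steer B).
Local Notation some_rough := (some_rough B).

(** With threshold [r / 80], a path that is not wild oscillates by at most [10 * r / 80 = r / 8]
    within a step. *)
Definition wild (s r : R) (n : nat) : set Omega :=
  some_rough s (8 * r ^+ 2 / n%:R) n (r / 80).

Definition step_prob (n : nat) : R := expR (- (74 ^+ 2)) / (1024 * n%:R).

Lemma step_prob_gt0 n : (0 < n)%N -> 0 < step_prob n.
Proof.
rewrite -(ltr0n R) => n0; have k0 : 0 < 1024 :> R by rewrite ltr0n.
exact: divr_gt0 (expR_gt0 _) (mulr_gt0 k0 n0).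
Qed.

Lemma step_prob_le1 n : (0 < n)%N -> step_prob n <= 1.
Proof.
rewrite -(ler1n R) => n1; rewrite /step_prob.
have e1 : expR (- (74 ^+ 2)) <= 1 :> R by rewrite expR_le1 oppr_le0 sqr_ge0.
move: (expR _) e1 => x x1.
rewrite ler_pdivrMr; lra.
Qed.

(** This is [n] times the factor of [pr_steps_rough] for [h = 8 r^2 / n], [lam = r / 80] and
    [c = step_prob n]: the powers of [r] cancel, and those of [n] leave [1 / n] in that factor. *)
Definition wild_const : R := 3072 * 8 ^+ 3 * 80 ^+ 6 * 1024 * expR (74 ^+ 2).

Lemma wild_const_ge0 : 0 <= wild_const.
Proof.
rewrite /wild_const; have h (k : nat) : 0 <= k%:R :> R by exact: ler0n.
by apply: mulr_ge0 (expR_ge0 _); apply: mulr_ge0 (h _); apply: mulr_ge0;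
  [apply: mulr_ge0 (h _) _|]; apply: exprn_ge0; exact: h.
Qed.

Lemma measurable_wild s r n : 0 <= s -> 0 < r -> (0 < n)%N -> measurable (wild s r n).
Proof.
move=> s0 r0 n0; have N0 : 0 < n%:R :> R by rewrite ltr0n.
have h0 : 0 < 8 * r ^+ 2 / n%:R by rewrite divr_gt0// mulr_gt0// exprn_gt0.
apply: bigsetU_measurable => i _; apply: (measurable_rough B_bm) => //.
by rewrite addr_ge0// mulr_ge0// ltW.
Qed.

Lemma trial s r n E : 0 <= s -> 0 < r -> (0 < n)%N -> past s E ->
  [/\ past (s + 8 * r ^+ 2) (E `&` steer s r n),
      pr E * step_prob n ^+ n <= pr (E `&` steer s r n) &
      pr (E `&` steer s r n `&` wild s r n) <=
        pr (E `&` steer s r n) * (wild_const / n%:R)].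
Proof.
move=> s0 r0 n0 Es; have N0 : 0 < n%:R :> R by rewrite ltr0n.
have h0 : 0 < 8 * r ^+ 2 / n%:R by rewrite divr_gt0// mulr_gt0// exprn_gt0.
have mQ i : measurable (square (target r n i) (r / (8 * n%:R))).
  exact: measurable_square.
have [EG prEG] := past_steps_grid B_bm n s0 (ltW h0) Es mQ.
split.
- by move: EG; rewrite divfK ?gt_eqF.
- rewrite prEG ler_wpM2l ?pr_ge0//.
  rewrite -[X in _ ^+ X](card_ord n) -prodr_const; apply: ler_prod => i _.
  rewrite ltW ?step_prob_gt0//=; exact: (pr_steer_step B_bm).
- have lam0 : 0 < r / 80 by rewrite divr_gt0.
  apply: le_trans (pr_steps_rough B_bm s0 h0 lam0 (step_prob_gt0 n0) Es mQ _) _.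
    by move=> i _; exact: (pr_steer_step B_bm).
  rewrite le_eqVlt; apply/orP; left; apply/eqP; congr (_ * _).
  rewrite /step_prob /wild_const expRN.
  have := expR_gt0 (74 ^+ 2 : R); move: (expR _) => x x0.
  move: (80 : R) (ltr0n R 80) => y /= y0.
  by field; rewrite !gt_eqF.
Qed.

Section sequence.
Variables (s r : nat -> R) (n : nat).
Hypotheses (s_gt0 : forall k, 0 < s k) (r_gt0 : forall k, 0 < r k).
Hypothesis s_step : forall k, s k + 8 * r k ^+ 2 <= s k.+1.
Hypothesis n_gt0 : (0 < n)%N.

(** The set removed is first intersected with [all_missed j], so that the difference is proper, as
    [past_setD] requires. *)
Fixpoint all_missed (k : nat) : set Omega :=
  if k is j.+1 then
    all_missed j `\` (all_missed j `&` steer (s j) (r j) n)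
  else setT.

Lemma past_all_missed k : past (s k) (all_missed k).
Proof.
elim: k => [|k IH] /=; first exact: past_setT.
have [EG _ _] := trial (ltW (s_gt0 k)) (r_gt0 k) n_gt0 IH.
apply: (past_setD B_bm) => //.
- by apply: le_trans (ltW (s_gt0 k)) (le_trans _ (s_step k)); rewrite lerDl mulr_ge0// sqr_ge0.
- by apply: past_le IH; rewrite (le_trans _ (s_step k))// lerDl mulr_ge0// sqr_ge0.
- by apply: past_le EG.
Qed.

Lemma pr_all_missed_step k : pr (all_missed k.+1) =
  pr (all_missed k) - pr (all_missed k `&` steer (s k) (r k) n).
Proof.
have Ek := past_all_missed k.
have [EG _ _] := trial (ltW (s_gt0 k)) (r_gt0 k) n_gt0 Ek.
by rewrite /= pr_setD//; [case: Ek|case: EG].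
Qed.

(** Given the earlier misses, a trial still succeeds with probability at least [step_prob n ^+ n],
    since its window comes after theirs. *)
Lemma pr_all_missed k : pr (all_missed k) <= (1 - step_prob n ^+ n) ^+ k.
Proof.
elim: k => [|k IH]; first by rewrite /= pr_setT.
have [_ h _] := trial (ltW (s_gt0 k)) (r_gt0 k) n_gt0 (past_all_missed k).
rewrite pr_all_missed_step exprSr.
have q1 : 0 <= 1 - step_prob n ^+ n.
  by rewrite subr_ge0 exprn_ile1 ?step_prob_le1 ?ltW ?step_prob_gt0.
have := ler_wpM2r q1 IH; rewrite mulrBr mulr1 => le1.
by apply: le_trans le1; rewrite lerD2l lerN2.
Qed.

Definition first_hit_wild k : set Omega :=
  all_missed k `&` steer (s k) (r k) n `&` wild (s k) (r k) n.

(** The events of a first success at [k] are disjoint and have total probability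
    [1 - pr (all_missed M)]. The bound is therefore uniform in the number of trials, which allows
    [n] to be fixed before [M]. *)
Lemma sum_first_hit_wild M :
  \sum_(k < M) pr (first_hit_wild k) <= (1 - pr (all_missed M)) * (wild_const / n%:R).
Proof.
elim: M => [|M IH]; first by rewrite big_ord0 /= pr_setT subrr mul0r.
have [_ _ h] := trial (ltW (s_gt0 M)) (r_gt0 M) n_gt0 (past_all_missed M).
rewrite big_ord_recr pr_all_missed_step; apply: le_trans (lerD IH h) _.
by rewrite -mulrDl opprB addrA addrAC.
Qed.

End sequence.

Lemma pr_rough_start s r : 0 < s -> 0 < r ->
  pr (rough 0 s (r / 80)) <= 3072 * (s ^+ 3 / (r / 80) ^+ 6).
Proof.
move=> s0 r0; have lam0 : 0 < r / 80 by rewrite divr_gt0.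
have := pr_rough B_bm (E := setT) (a := 0) (h := s) (lam := r / 80) (c := 1).
rewrite setTI mul1r; apply => // u v x _ _ _.
by rewrite setTI mul1r.
Qed.

End trials.

(** * Choice of the scales and conclusion *)

Section conclusion.
Context {R : realType} {d : measure_display} {Omega : measurableType d}.
Variables (P : probability Omega R) (B : R -> Omega -> R * R) (z : R * R).
Hypothesis B_bm : planar_brownian_motion P B z.
Local Notation pr := (pr P).
Local Notation rough := (rough B).
Local Notation steer := (steer B).
Local Notation wild := (wild B).

Lemma nat_above (x : R) : exists n : nat, x <= n%:R.
Proof. by exists (Num.truncn x).+1; rewrite ltW// truncnS_gt. Qed.

Lemma expr_small (x e : R) : 0 <= x < 1 -> 0 < e -> exists M, x ^+ M <= e.
Proof.
move=> /andP[x0 x1] e0.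
have /cvgrPdist_le/(_ e e0)[M _ /(_ M (leqnn M))] := cvg_expr (z := x) ltac:(by rewrite ger0_norm).
by rewrite /= sub0r normrN ger0_norm ?exprn_ge0//; exists M.
Qed.

Lemma all_missedPn s r n M w : ~ all_missed B s r n M w ->
  exists k, [/\ (k < M)%N, all_missed B s r n k w & steer (s k) (r k) n w].
Proof.
elim: M => [|M IH] /=; first by move=> /(_ I).
have [Ew|Ew] := pselect (all_missed B s r n M w); last first.
  by move=> _; have [k [kM ? ?]] := IH Ew; exists k; split => //; exact: ltnW.
move=> nE; exists M; split => //; apply: contrapT => nG.
by apply: nE; split => // -[].
Qed.

(** The value [1664 = 26 * 8 * 8] makes the scaled curve move by at most [r / 8] during one step. *)
Definition good_trial (delta : R) w s r n : Prop :=
  [/\ 0 < s, 0 < r, 10 * r <= delta & 1664 <= n%:R :> R] /\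
  [/\ steer s r n w, ~ wild s r n w & ~ rough 0 s (r / 80) w].

(** The failure probability is split into thirds: no success, a wild first success, a rough start
    before some window. These are made small by choosing [n], then [M], then [m], except that [M]
    settles the first and [n] the second. *)
Lemma failure_set (delta e : R) : 0 < delta -> 0 < e ->
  exists F : set Omega, [/\ measurable F, pr F <= e &
    forall w, ~ F w -> exists s r n, good_trial delta w s r n].
Proof.
move=> d0 e0.
have [n nP] := nat_above (Num.max 1664 (3 * wild_const / e)).
move: nP; rewrite ge_max => /andP[n1664 nwild].
have N0 : 0 < n%:R :> R by lra.
have n0 : (0 < n)%N by rewrite -(ltr0n R).
have c0 := @step_prob_gt0 R n n0; have c1 := @step_prob_le1 R n n0.
have [||M ME] := @expr_small (1 - step_prob n ^+ n : R) (e / 3) _ _.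
- by rewrite subr_ge0 exprn_ile1 ?(ltW c0)//= gtrBl exprn_gt0.
- by rewrite divr_gt0.
pose K : R := 3072 * 80 ^+ 6.
pose m := Num.max 1 (3 * M%:R * K / e).
have m1 : 1 <= m by rewrite /m le_max lexx.
have mK : 3 * M%:R * K / e <= m by rewrite /m le_max lexx orbT.
have m0 : 0 < m by lra.
have q1 : 1 <= 3 * m by lra.
have q0 : 0 < 3 * m by lra.
(* The scales grow by the factor [3 m] up to [r M = delta / 10]. With [s k = r k ^+ 2 / m] this
   gives [s k.+1 = 9 m * r k ^+ 2], beyond the end of window [k], while the start has probability at
   most [K / m^3] of being rough. *)
pose r k := delta / 10 * ((3 * m) ^+ k / (3 * m) ^+ M).
pose s k := r k ^+ 2 / m.
have r0 k : 0 < r k by rewrite !mulr_gt0// ?invr_gt0 ?exprn_gt0.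
have s0 k : 0 < s k by rewrite divr_gt0// exprn_gt0.
have sS k : s k + 8 * r k ^+ 2 <= s k.+1.
  have -> : s k.+1 = 9 * m * r k ^+ 2.
    rewrite /s (_ : r k.+1 = 3 * m * r k); last by rewrite /r exprS; ring.
    by field; rewrite gt_eqF.
  have : s k <= r k ^+ 2 by rewrite /s ler_pdivrMr// ler_peMr// sqr_ge0.
  have : 9 * r k ^+ 2 <= 9 * m * r k ^+ 2.
    by rewrite ler_wpM2r ?sqr_ge0//; lra.
  by lra.
have rd k : (k <= M)%N -> 10 * r k <= delta.
  move=> kM; rewrite /r mulrA (_ : 10 * (delta / 10) = delta); last by field.
  rewrite ler_piMr ?(ltW d0)// ler_pdivrMr ?exprn_gt0// mul1r.
  exact: ler_weXn2l.
pose D k := rough 0 (s k) (r k / 80).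
have mD k : measurable (D k) by exact: (measurable_rough B_bm).
pose W k := first_hit_wild B s r n k.
have mE k : measurable (all_missed B s r n k).
  by have [] := past_all_missed B_bm s0 r0 sS n0 k.
have mW k : measurable (W k).
  have [[mG _] _ _] := trial B_bm (ltW (s0 k)) (r0 k) n0
    (past_all_missed B_bm s0 r0 sS n0 k).
  by apply: measurableI => //; apply: (measurable_wild B_bm) => //; exact: ltW.
pose A := all_missed B s r n M.
pose F := A `|` \big[setU/set0]_(k < M) (W k `|` D k).
have mF : measurable F.
  apply: measurableU; first exact: mE.
  by apply: bigsetU_measurable => k _; exact: measurableU.
exists F; split => //.
- have prA : pr A <= e / 3 by apply: le_trans ME; exact: (pr_all_missed B_bm).
  have prW : \sum_(k < M) pr (W k) <= e / 3.
    apply: le_trans (sum_first_hit_wild B_bm s0 r0 sS n0 M) _.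
    apply: (@le_trans _ _ (wild_const / n%:R)).
      rewrite ler_piMl ?gerBl ?pr_ge0//.
      exact: divr_ge0 wild_const_ge0 (ltW N0).
    by rewrite ler_pdivrMr//; move: nwild; rewrite ler_pdivrMr//; lra.
  have prD k : pr (D k) <= K / m.
    apply: le_trans (pr_rough_start B_bm (s0 k) (r0 k)) _.
    rewrite /K -(mulrA 3072); apply: ler_wpM2l (ler0n _ _) _ _ _.
    have -> : s k ^+ 3 / (r k / 80) ^+ 6 = 80 ^+ 6 / m ^+ 3.
      rewrite /s; move: (r k) (r0 k) (80 : R) (ltr0n R 80) => x x0 y /= y0.
      by field; rewrite !gt_eqF.
    apply: ler_wpM2l; first by apply: exprn_ge0; exact: ler0n.
    by rewrite lef_pV2 ?posrE ?exprn_gt0// exprS ler_peMr ?(ltW m0)// exprn_ege1.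
  have prD_sum : \sum_(k < M) pr (D k) <= e / 3.
    apply: le_trans (ler_sum _ (fun (k : 'I_M) _ => prD k)) _.
    rewrite sumr_const card_ord -[leLHS]mulr_natl mulrA ler_pdivrMr//.
    by move: mK; rewrite ler_pdivrMr//; lra.
  have mWD (k : nat) : (k < M)%N -> measurable (W k `|` D k).
    by move=> _; exact: measurableU.
  have prWD : pr (\big[setU/set0]_(k < M) (W k `|` D k)) <=
      \sum_(k < M) (pr (W k) + pr (D k)).
    rewrite -lee_fin -prE; last by apply: bigsetU_measurable => j _; exact: mWD.
    apply: le_trans (Boole_inequality _ mWD) _; rewrite -sumEFin.
    apply: lee_sum => j _.
    have PF : (P (W j `|` D j) <= (pr (W j) + pr (D j))%:E)%E.
      by rewrite prE ?lee_fin ?pr_setU//; exact: mWD.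
    exact: PF.
  rewrite /F; apply: le_trans (pr_setU P (mE M) _) _.
    by apply: bigsetU_measurable => j _; exact: mWD.
  rewrite [leRHS]big_split/= in prWD.
  apply: le_trans (lerD prA (le_trans prWD (lerD prW prD_sum))) _.
  by lra.
- move=> w nF.
  have nA : ~ A w by move=> Aw; apply: nF; left.
  have [k [kM Ew Gw]] := all_missedPn nA.
  have nWD : ~ (W k `|` D k) w.
    move=> WD; apply: nF; right.
    by rewrite -(bigcup_mkord _ (fun k => W k `|` D k)); exists k.
  exists (s k), (r k), n; split; first by split => //; apply: rd; exact: ltnW.
  split => //.
    by move=> wild_w; apply: nWD; left.
  by move=> rough_w; apply: nWD; right.
Qed.

Lemma grid_index n (t : R) : (0 < n)%N -> 0 <= t <= 8 ->
  exists2 i, (i < n)%N & 8 / n%:R * i%:R <= t <= 8 / n%:R * i.+1%:R.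
Proof.
move=> n0 /andP[t0 t8]; have N0 : 0 < n%:R :> R by rewrite ltr0n.
have [t_lt|] := ltP t 8; last first.
  (* At [t = 8] truncation would give the index [n]; the last step is taken instead. *)
  move=> t8'; have -> : t = 8 by lra.
  exists n.-1; first by rewrite ltn_predL.
  rewrite prednK// divfK ?gt_eqF// lexx andbT.
  by rewrite mulrAC ler_pdivrMr// ler_wpM2l// ler_nat leq_pred.
have x0 : 0 <= t * n%:R / 8 by rewrite divr_ge0// mulr_ge0// ltW.
have /andP[i1 i2] := truncn_itv x0.
exists (Num.truncn (t * n%:R / 8)).
  rewrite -(ltr_nat R); apply: le_lt_trans i1 _.
  by rewrite ltr_pdivrMr// mulrC ltr_pM2l.
move: i1 i2; set i := Num.truncn _; rewrite ler_pdivlMr// ltr_pdivrMr// => i1 i2.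
by rewrite mulrAC ler_pdivrMr// mulrAC ler_pdivlMr//; lra.
Qed.

Lemma drift_step (x0 x1 x2 c1 c2 r y e : R) :
  `|x1 - x0 - r * c1| <= y -> `|x2 - x1 - r * (c2 - c1)| <= e ->
  `|x2 - x0 - r * c2| <= y + e.
Proof.
move=> h1 h2; apply: le_trans (lerD h1 h2); apply: le_trans (ler_normD _ _).
by rewrite le_eqVlt; apply/orP; left; apply/eqP; congr (`| _ |); ring.
Qed.

(** The error [r / 2] allowed in the tube is the sum of four terms [r / 8]: displacement before [s],
    accumulated steering errors, oscillation of the path within a step, and variation of the scaled
    curve within that step. *)
Lemma good_trial_encircles delta w s r n :
  B 0 w = z -> {within `[0, +oo[, continuous (fun t => B t w)} ->
  good_trial delta w s r n ->
  let I := time_interval (exit_time z delta (fun t => B t w)) in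
  exists eps : R, 0 < eps /\
    forall b : R -> R * R, {within I, continuous b} ->
      (sup_dist I b (fun t => B t w) < eps%:E)%E ->
      exists V : set (R * R),
        [/\ open V, bounded_set V, V z & boundary V `<=` b @` I].
Proof.
move=> B0 cB [[s0 r0 rd n1664] [Gw nW nD]].
have lam0 : 0 <= r / 80 by rewrite divr_ge0// ltW.
have N0 : 0 < n%:R :> R by lra.
have n0 : (0 < n)%N by rewrite -(ltr0n R).
set h := 8 * r ^+ 2 / n%:R.
have h0 : 0 < h by rewrite divr_gt0// mulr_gt0// exprn_gt0.
have hE : h = r ^+ 2 * (8 / n%:R) by rewrite /h mulrAC mulrC.
have start t : 0 <= t <= s ->
    `|(B t w).1 - z.1| <= r / 8 /\ `|(B t w).2 - z.2| <= r / 8.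
  move=> ts; have := not_rough_oscillation (lexx 0) s0 lam0 cB nD (t := t).
  by rewrite add0r B0 => /(_ ts); lra.
have curve0 : curve 0 = (0, 0) :> R * R.
  have [[c0 _ _ _] _] := @curve_edges R 0.
  by rewrite c0 ?mulr0// lexx ler01.
have grid i : (i <= n)%N ->
    `|(B (s + h * i%:R) w).1 - (B s w).1 - r * (curve (8 / n%:R * i%:R)).1| <=
      i%:R * (r / (8 * n%:R)) /\
    `|(B (s + h * i%:R) w).2 - (B s w).2 - r * (curve (8 / n%:R * i%:R)).2| <=
      i%:R * (r / (8 * n%:R)).
  elim: i => [_|i IH iN].
    by rewrite !mulr0 addr0 curve0 !mulr0 !subrr normr0 mul0r.
  have [h1 h2] := IH (ltnW iN).
  have [/= g1 g2] := Gw i iN; rewrite -/h in g1 g2.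
  set e := r / (8 * n%:R) in g1 g2 h1 h2 *.
  have -> : i.+1%:R * e = i%:R * e + e by rewrite -natr1 mulrDl mul1r.
  by split; [exact: drift_step h1 g1|exact: drift_step h2 g2].
apply: (@tube_encircles R (fun t => B t w) z delta r s r0 rd (ltW s0) start).
move=> t t8.
have [i iN /andP[it ti]] := grid_index n0 t8.
have [g1 g2] := grid i (ltnW iN).
have iE : i%:R * (r / (8 * n%:R)) <= r / 8.
  have -> : i%:R * (r / (8 * n%:R)) = r / 8 * (i%:R / n%:R).
    by field; rewrite gt_eqF.
  rewrite ler_piMr ?divr_ge0 ?(ltW r0)//.
  by rewrite ler_pdivrMr// mul1r ler_nat ltnW.
have [v1 v2] : `|(B (s + r ^+ 2 * t) w).1 - (B (s + h * i%:R) w).1| <= 10 * (r / 80) /\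
               `|(B (s + r ^+ 2 * t) w).2 - (B (s + h * i%:R) w).2| <= 10 * (r / 80).
  apply: (@not_rough_oscillation _ _ _ B (s + h * i%:R) h (r / 80)) => //.
  - by rewrite addr_ge0 ?(ltW s0)// mulr_ge0// ltW.
  - move=> ro; apply: nW; rewrite /wild /some_rough -/h.
    by rewrite -(bigcup_mkord _ (fun i => rough (s + h * i%:R) h (r / 80))); exists i.
  - have r20 : 0 <= r ^+ 2 by exact: sqr_ge0.
    have a1 := ler_wpM2l r20 it; have a2 := ler_wpM2l r20 ti.
    by move: a1 a2; rewrite -natr1 hE; lra.
have [b1 b2] := start s (introT andP (conj (ltW s0) (lexx s))).
have [l1 l2] := curve_lipschitz it.
have tiN : 26 * (t - 8 / n%:R * i%:R) <= 1 / 8.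
  have : 26 * (8 / n%:R) <= 1 / 8 :> R by rewrite mulrA ler_pdivrMr//; lra.
  by move: ti; rewrite -natr1; lra.
have rc (x y : R) : `|x - y| <= 26 * (t - 8 / n%:R * i%:R) ->
    - (r / 8) <= r * x - r * y <= r / 8.
  move=> /le_trans/(_ tiN); rewrite ler_norml => /andP[u1 u2].
  by move: (ler_wpM2l (ltW r0) u1) (ler_wpM2l (ltW r0) u2); lra.
have := rc _ _ l1; have := rc _ _ l2.
move: g1 g2 v1 v2 b1 b2; rewrite !ler_norml; clear - iE r0.
move: (i%:R * _) iE => y.
by lra.
Qed.

End conclusion.

Theorem proposition4p11 (R : realType) (d : measure_display)
    (Omega : measurableType d) (P : probability Omega R)
    (z : R * R) (delta : R) (B : R -> Omega -> R * R)
    (delta_gt0 : 0 < delta) (B_bm : planar_brownian_motion P B z) :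
  {ae P, forall w,
    let path := fun t => B t w in
    let I := time_interval (exit_time z delta path) in
    exists eps : R, 0 < eps /\
      forall b : R -> R * R,
        {within I, continuous b} ->
        (sup_dist I b path < eps%:E)%E ->
        exists V : set (R * R),
          [/\ open V, bounded_set V, V z & boundary V `<=` b @` I]}.
Proof.
(* Failure sets of probability at most [1 / (j + 1)] are chosen for all [j]; their intersection is
   null, and off it some trial is good. *)
have fail j := failure_set B_bm delta_gt0 (divr_gt0 ltr01 (ltr0Sn R j)).
pose F j : set Omega := sval (cid (fail j)).
have FP j : [/\ measurable (F j), pr P (F j) <= 1 / j.+1%:R &
    forall w, ~ F j w -> exists s r n, good_trial B delta w s r n].
  exact: (svalP (cid (fail j))).
pose N := \bigcap_j F j.
have mN : measurable N.
  by apply: bigcap_measurable; [exists 0%N|move=> j _; have [] := FP j].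
have N0 : pr P N = 0.
  apply/eqP; rewrite eq_le pr_ge0 andbT; apply/ler_addgt0Pr => e e0.
  have [j ej] := nat_above (1 / e).
  have [mF Fj _] := FP j; rewrite add0r.
  apply: (le_trans (le_pr P mN mF _)); first by move=> w; exact.
  apply: le_trans Fj _; rewrite ler_pdivrMr ?ltr0Sn// mulrC -ler_pdivrMr//.
  by rewrite (le_trans ej)// ler_nat.
have aeN : {ae P, forall w, ~ N w}.
  exists N; split => //; first by rewrite prE// N0.
  by move=> w /= /contrapT.
apply: filterS3 (bm_start B_bm) (bm_continuous B_bm) aeN => w B0 cB nN.
have [j nF] : exists j, ~ F j w.
  by apply/existsNP => Fw; apply: nN => j _; exact: Fw.
have [_ _ /(_ w nF)[s [r [n good]]]] := FP j.
exact: good_trial_encircles good.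
Qed.
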